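(* Let $\mathcal M=(M,<,\ldots)$ be a $*$-locally weakly o-minimal structure with the $*$-continuity property. Let $X_1,\ldots,X_m$ be definable subsets of $M^n$. Then there is a decomposition $\{C_i\}_{i=1}^N$ of $M^n$ into normal submanifolds partitioning $\{X_j\}_{j=1}^m$ and satisfying the frontier condition. Furthermore, $N$ is bounded above by a number depending only on $m$ and $n$.
   Context: $\mathcal M$ is an expansion of a dense linear order without endpoints; ''definable'' means with parameters; order and product topologies. $\overline M=M\cup\{\text{definable gaps}\}$, where a definable gap is a pair $(A,B)$ of nonempty definable subsets of $M$ with $M=A\cup B$, $A<B$, $A$ without maximum, $B$ without minimum, with the natural order; for an open interval $I=(b_1,b_2)$, $\overline I=\{x\in\overline M:b_1<x<b_2\}$. $*$-locally weakly o-minimal: for every definable $X\subseteq M$ and every $\bar a\in\overline M$ there is an open interval $I$ with $\bar a\in\overline I$ such that $X\cap I$ is a union of a finite set and finitely many open convex sets. A definable function $F:X\to\overline M$ is one given by $F(x)=\sup Y_x$ for a definable $Y$ projecting onto $X$. $*$-continuity property: for every definable $f:B\to\overline M$ on a nonempty open box $B$ there is a nonempty open box $U\subseteq B$ with $f|_U$ continuous. For definable $X\subseteq M^n$ and a coordinate projection $\pi:M^n\to M^d$, a point $x\in X$ is $(X,\pi)$-normal if there is an open box $B\ni x$ such that, after permuting coordinates so that $\pi$ is the projection onto the first $d$ coordinates, $B\cap X$ is the graph of a continuous map defined on $\pi(B)$. $X$ is a normal submanifold if there is a coordinate projection $\pi$ such that every point of $X$ is $(X,\pi)$-normal. A decomposition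 of $M^n$ into normal submanifolds partitioning $\{X_j\}$ is a finite family of pairwise disjoint definable normal submanifolds $C_i$ with union $M^n$ such that for all $i,j$ either $C_i\cap X_j=\emptyset$ or $C_i\subseteq X_j$; it satisfies the frontier condition if the closure of each $C_i$ is a union of members of the family. *)

(* Defs.v *)
From HB Require Import structures.
From mathcomp Require Import all_boot all_order all_algebra.
From mathcomp Require Import all_classical.
From mathcomp Require Import interval_inference topology.

Set Implicit Arguments.
Unset Strict Implicit.
Unset Printing Implicit Defensive.

Import Order.TTheory.
Local Open Scope classical_set_scope.
Local Open Scope order_scope.

(* M^n is {ptws 'I_n -> M}, the functions 'I_n -> M with the product topology. *)

(** * Expansions of an ordered set and definable sets *)

(* Non-logical symbols besides <, graded by arity; constants are 0-ary. *)
Record signature := Signature {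
  fsym : nat -> Type;
  rsym : nat -> Type }.

Record expansion (S : signature) d (M : orderTopologicalType d) := Expansion {
  fun_int : forall k, fsym S k -> ('I_k -> M) -> M;
  rel_int : forall k, rsym S k -> ('I_k -> M) -> Prop }.

Definition dense_without_endpoints d (M : orderTopologicalType d) : Prop :=
  [/\ inhabited M,
      forall x y : M, x < y -> exists z, x < z < y,
      forall x : M, exists y, y < x
    & forall x : M, exists y, x < y].

(* Terms and formulas carry elements of M as constants, so that a formula in n
   free variables is one with parameters. *)
Inductive term (S : signature) (M : Type) (n : nat) : Type :=
  | Var of 'I_n
  | Par of M
  | App k of fsym S k & ('I_k -> term S M n).

Inductive formula (S : signature) (M : Type) : nat -> Type :=
  | Eq n of term S M n & term S M n : formula S M n
  | Lt n of term S M n & term S M n : formula S M n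
  | Rel n k of rsym S k & ('I_k -> term S M n) : formula S M n
  | Neg n of formula S M n : formula S M n
  | Conj n of formula S M n & formula S M n : formula S M n
  | Exists n of formula S M n.+1 : formula S M n.

(* (x, y) in M^n x M = M^(n+1); an existential quantifier binds the last
   variable. *)
Definition snoc (M : Type) n (x : 'I_n -> M) (y : M) : 'I_n.+1 -> M :=
  fun i => if unlift ord_max i is Some j then x j else y.

Section Semantics.
Context (S : signature) d (M : orderTopologicalType d) (E : expansion S M).

Fixpoint eval n (t : term S M n) (x : 'I_n -> M) : M :=
  match t with
  | Var i => x i
  | Par a => a
  | App _ f ts => fun_int E f (fun i => eval (ts i) x)
  end.

Fixpoint sat n (phi : formula S M n) : ('I_n -> M) -> Prop :=
  match phi with
  | Eq _ t u => fun x => eval t x = eval u x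
  | Lt _ t u => fun x => eval t x < eval u x
  | Rel _ _ r ts => fun x => rel_int E r (fun i => eval (ts i) x)
  | Neg _ phi1 => fun x => ~ sat phi1 x
  | Conj _ phi1 phi2 => fun x => sat phi1 x /\ sat phi2 x
  | Exists _ phi1 => fun x => exists y, sat phi1 (snoc x y)
  end.

Definition definable n (X : set {ptws 'I_n -> M}) : Prop :=
  exists phi : formula S M n, X = [set x | sat phi x].

Definition definable1 (X : set M) : Prop :=
  definable [set x : {ptws 'I_1 -> M} | X (x ord0)].

End Semantics.

(** * The completion by definable gaps *)

Section Completion.
Context (S : signature) d (M : orderTopologicalType d) (E : expansion S M).

Record gap := MkGap {
  lower : set M;
  upper : set M;
  lower_definable : definable1 E lower;
  upper_definable : definable1 E upper;
  lower_neq0 : lower !=set0;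
  upper_neq0 : upper !=set0;
  gap_cover : lower `|` upper = setT;
  gap_lt : forall a b, lower a -> upper b -> a < b;
  lower_nomax : forall a, lower a -> exists2 b, lower b & a < b;
  upper_nomin : forall b, upper b -> exists2 a, upper a & a < b }.

Inductive completion := Elt of M | Gap of gap.

Definition le_completion (x y : completion) : bool :=
  match x, y with
  | Elt a, Elt b => a <= b
  | Elt a, Gap g => `[< lower g a >]
  | Gap g, Elt b => `[< upper g b >]
  | Gap g, Gap h => `[< lower g `<=` lower h >]
  end.

Lemma upperP (g : gap) a : upper g a <-> ~ lower g a.
Proof.
split=> [ub la|nla]; first by have := gap_lt la ub; rewrite ltxx.
by have : [set: M] a by []; rewrite -(gap_cover g) => -[].
Qed.

Lemma lower_le (g : gap) a b : a <= b -> lower g b -> lower g a.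
Proof.
move=> ab lb; have [//|/upperP ua] := pselect (lower g a).
by have := lt_le_trans (gap_lt lb ua) ab; rewrite ltxx.
Qed.

Lemma gap_eq (g h : gap) : lower g = lower h -> g = h.
Proof.
move=> gh; have : upper g = upper h.
  by apply/seteqP; split=> a /upperP na; apply/upperP; rewrite (gh, =^~ gh).
case: g h gh => [A B ? ? ? ? ? ? ? ?] [A' B' ? ? ? ? ? ? ? ?] /= AA' BB'.
by subst A' B'; congr MkGap; exact: Prop_irrelevance.
Qed.

HB.instance Definition _ := gen_eqMixin completion.
HB.instance Definition _ := gen_choiceMixin completion.

Lemma le_completion_refl : reflexive le_completion.
Proof. by move=> [a|g] /=; [exact: lexx|exact/asboolP]. Qed.

Lemma le_completion_anti : antisymmetric le_completion.
Proof.
move=> [a|g] [b|h] /= /andP[].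
- by move=> ab ba; congr Elt; apply/le_anti; rewrite ab.
- by move=> /asboolP la /asboolP /upperP.
- by move=> /asboolP /upperP ? /asboolP.
- by move=> /asboolP gh /asboolP hg; congr Gap; apply/gap_eq/seteqP.
Qed.

Lemma le_completion_trans : transitive le_completion.
Proof.
move=> [b|h] [a|g] [c|k] /=.
- exact: le_trans.
- by move=> ab /asboolP lb; apply/asboolP; exact: lower_le ab lb.
- move=> /asboolP /upperP lb bc; apply/asboolP/upperP => lc.
  by apply: lb; exact: lower_le bc lc.
- move=> /asboolP ub /asboolP lb; apply/asboolP => a la.
  by apply: lower_le lb; exact/ltW/(gap_lt la ub).
- by move=> /asboolP la /asboolP uc; exact/ltW/(gap_lt la uc).
- by move=> /asboolP la /asboolP hk; apply/asboolP/hk.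
- move=> /asboolP gh /asboolP /upperP uc; apply/asboolP/upperP => lc.
  by apply/uc/gh.
- by move=> /asboolP gh /asboolP hk; apply/asboolP; exact: subset_trans hk.
Qed.

Lemma le_completion_total : total le_completion.
Proof.
move=> [a|g] [b|h] /=.
- exact: le_total.
- have [la|/upperP ua] := pselect (lower h a); apply/orP.
    by left; apply/asboolP.
  by right; apply/asboolP.
- have [lb|/upperP ub] := pselect (lower g b); apply/orP.
    by right; apply/asboolP.
  by left; apply/asboolP.
- have [gh|ngh] := pselect (lower g `<=` lower h); apply/orP.
    by left; apply/asboolP.
  right; apply/asboolP => b lb.
  have [//|/upperP ub] := pselect (lower g b).
  exfalso; apply: ngh => a la; apply: lower_le lb.
  exact/ltW/(gap_lt la ub).
Qed.

HB.instance Definition _ := Order.Le_isPOrder.Build d completion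
  le_completion_refl le_completion_anti le_completion_trans.
HB.instance Definition _ :=
  Order.POrder_isTotal.Build d completion le_completion_total.

HB.instance Definition _ :=
  Topological.copy completion (order_topology completion).
HB.instance Definition _ :=
  Order_isNbhs.Build d completion (@order_nbhs_itv d completion).

(* F represents a definable function X -> completion; its values outside X are
   irrelevant. *)
Definition definable_fun n (X : set {ptws 'I_n -> M})
    (F : {ptws 'I_n -> M} -> completion) : Prop :=
  exists Y : set {ptws 'I_n.+1 -> M},
    [/\ definable E Y,
        X = [set x | exists y, Y (snoc x y)]
      & forall x, X x -> supremums [set Elt y | y in [set y | Y (snoc x y)]] (F x)].

End Completion.

(** * Boxes and the two hypotheses on the structure *)

Definition order_convex d (M : orderTopologicalType d) (C : set M) : Prop :=
  forall x y z, C x -> C y -> x <= z <= y -> C z.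

Definition open_box d (M : orderTopologicalType d) n
    (B : set {ptws 'I_n -> M}) : Prop :=
  exists I : 'I_n -> interval M,
    (forall i, itv_open_ends (I i)) /\ B = [set x | forall i, x i \in I i].

Section Hypotheses.
Context (S : signature) d (M : orderTopologicalType d) (E : expansion S M).

Definition star_locally_weakly_o_minimal : Prop :=
  forall (X : set M) (a : completion E), definable1 E X ->
  exists I : interval M,
    [/\ itv_open_ends I,
        a \in map_itv (@Elt S d M E) I
      & exists (F : set M) (k : nat) (C : 'I_k -> set M),
        [/\ finite_set F,
            forall j, open (C j) /\ order_convex (C j)
          & X `&` [set` I] = F `|` \bigcup_j C j]].

Definition star_continuity : Prop :=
  forall n (B : set {ptws 'I_n -> M}) (f : {ptws 'I_n -> M} -> completion E),
  open_box B -> B !=set0 -> definable_fun B f ->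
  exists U : set {ptws 'I_n -> M},
    [/\ open_box U, U !=set0, U `<=` B & {within U, continuous f}].

End Hypotheses.

(** * Normal submanifolds and decompositions *)

Section Decompositions.
Context d (M : orderTopologicalType d).

(* The coordinate projection M^n -> M^m given by an injective choice of
   coordinates tau is x |-> x \o tau. *)

(* sigma permutes the coordinates so that tau selects the first m ones. *)
Definition normal_point n m (X : set {ptws 'I_n -> M}) (tau : 'I_m -> 'I_n)
    (x : {ptws 'I_n -> M}) : Prop :=
  X x /\
  exists (k : nat) (sigma : 'I_(m + k) -> 'I_n) (B : set {ptws 'I_n -> M})
         (f : {ptws 'I_m -> M} -> {ptws 'I_k -> M}),
    let piB : set {ptws 'I_m -> M} := [set y \o tau | y in B] in
    [/\ bijective sigma /\ sigma \o @lshift m k = tau,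
        open_box B /\ B x,
        {within piB, continuous f}
      & [set y \o sigma | y in B `&` X] =
        [set z : 'I_(m + k) -> M | piB (z \o @lshift m k) /\
                                   z \o @rshift m k = f (z \o @lshift m k)]].

Definition normal_submanifold n (X : set {ptws 'I_n -> M}) : Prop :=
  exists (m : nat) (tau : 'I_m -> 'I_n),
    injective tau /\ forall x, X x -> normal_point X tau x.

Definition is_decomposition S (E : expansion S M) n N
    (C : 'I_N -> set {ptws 'I_n -> M}) : Prop :=
  [/\ forall i, definable E (C i) /\ normal_submanifold (C i),
      forall i j, i != j -> C i `&` C j = set0
    & \bigcup_i C i = setT].

Definition partitioning n N (C : 'I_N -> set {ptws 'I_n -> M}) m
    (X : 'I_m -> set {ptws 'I_n -> M}) : Prop :=
  forall i j, C i `&` X j = set0 \/ C i `<=` X j.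

Definition frontier_condition n N
    (C : 'I_N -> set {ptws 'I_n -> M}) : Prop :=
  forall i, exists J : set 'I_N, closure (C i) = \bigcup_(j in J) C j.

End Decompositions.

(* Main.v *)
(* Call a definable set large when it has nonempty interior, and let dim X < e mean
   that no projection of X to e coordinates is large.  Local weak o-minimality at the
   points of the completion decides every definable set on the right germ of every
   definable cut; applied to suprema of fibers, which are generically continuous, this
   shows that largeness is a prime property for finite unions, that a family with large
   base and large one-dimensional fibers is large, and that the small fibers over a
   large base generically contain isolated points varying continuously with the base.
   Hence, if dim X <= e, the points near which X is not the graph of a continuous map
   of e coordinates form a set of dimension < e, and so does the frontier of X.

   The decomposition proceeds downwards on the dimension of a closed set W, the part of
   M^n not yet decomposed.  The pieces of top dimension are cut out of W as relatively
   open subsets, one for each atom of the given sets and each choice of coordinates;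
   the remainder is closed of smaller dimension, and adding the closures of the pieces
   to the sets to be partitioned makes the frontier condition hold. *)
Require Import Defs.
From HB Require Import structures.
From mathcomp Require Import all_boot all_order all_algebra.
From mathcomp Require Import all_classical.
From mathcomp Require Import topology.
From mathcomp Require Import interval_inference.

Set Implicit Arguments.
Unset Strict Implicit.
Unset Printing Implicit Defensive.

Import Order.TTheory.
Local Open Scope order_scope.
Local Open Scope classical_set_scope.

(** * Definable sets *)

Definition from_ord0 (T : Type) (k : 'I_0) : T := match notF (ltn_ord k) with end.

Section Points.
Context (T : Type).

Definition init n (x : 'I_n.+1 -> T) : 'I_n -> T := fun i => x (lift ord_max i).
Definition final n (x : 'I_n.+1 -> T) : T := x ord_max.
Definition lpart n k (x : 'I_(n + k) -> T) : 'I_n -> T := fun i => x (lshift k i).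
Definition rpart n k (x : 'I_(n + k) -> T) : 'I_k -> T := fun i => x (rshift n i).
Definition cat_pt n k (x : 'I_n -> T) (y : 'I_k -> T) : 'I_(n + k) -> T :=
  fun i => match fintype.split i with inl a => x a | inr b => y b end.

Lemma init_snoc n (x : 'I_n -> T) y : init (snoc x y) = x.
Proof. by apply/funext => i; rewrite /init /snoc liftK. Qed.

Lemma final_snoc n (x : 'I_n -> T) y : final (snoc x y) = y.
Proof. by rewrite /final /snoc unlift_none. Qed.

Lemma snoc_lift n (x : 'I_n -> T) y i : snoc x y (lift ord_max i) = x i.
Proof. by rewrite /snoc liftK. Qed.

Lemma snoc_max n (x : 'I_n -> T) y : snoc x y ord_max = y.
Proof. by rewrite /snoc unlift_none. Qed.

Lemma snoc_eta n (x : 'I_n.+1 -> T) : snoc (init x) (final x) = x.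
Proof.
apply/funext => i; case: (unliftP ord_max i) => [j ->|->].
  by rewrite snoc_lift.
by rewrite snoc_max.
Qed.

Lemma lpart_cat n k (x : 'I_n -> T) (y : 'I_k -> T) : lpart (cat_pt x y) = x.
Proof.
by apply/funext => i; rewrite /lpart /cat_pt (unsplitK (inl i : 'I_n + 'I_k)).
Qed.

Lemma rpart_cat n k (x : 'I_n -> T) (y : 'I_k -> T) : rpart (cat_pt x y) = y.
Proof.
by apply/funext => i; rewrite /rpart /cat_pt (unsplitK (inr i : 'I_n + 'I_k)).
Qed.

End Points.

(** * Substitution and closure properties of definable predicates *)

Section Definability.
Context (S : signature) d (M : orderTopologicalType d) (E : expansion S M).

Fixpoint term_subst n k (v : 'I_n -> term S M k) (t : term S M n) : term S M k :=
  match t with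
  | Var i => v i
  | Par a => Par S k a
  | App l f ts => App f (fun i => term_subst v (ts i))
  end.

(** Substitution under a quantifier: the bound variable is the last one, so it is fixed and the
    other terms are renamed past it to avoid capture. *)
Definition term_lift n k (v : 'I_n -> term S M k) : 'I_n.+1 -> term S M k.+1 :=
  fun i => if unlift ord_max i is Some j
           then term_subst (fun l => Var S M (lift ord_max l)) (v j)
           else Var S M ord_max.

Fixpoint formula_subst n (phi : formula S M n) :
    forall k, ('I_n -> term S M k) -> formula S M k :=
  match phi with
  | Eq _ t u => fun _ v => Eq (term_subst v t) (term_subst v u)
  | Lt _ t u => fun _ v => Lt (term_subst v t) (term_subst v u)
  | Rel _ _ r ts => fun _ v => Rel r (fun i => term_subst v (ts i))
  | Neg _ phi1 => fun _ v => Neg (formula_subst phi1 v)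
  | Conj _ phi1 phi2 => fun _ v => Conj (formula_subst phi1 v) (formula_subst phi2 v)
  | Exists _ phi1 => fun _ v => Exists (formula_subst phi1 (term_lift v))
  end.

Lemma eval_subst n k (v : 'I_n -> term S M k) t x :
  Defs.eval E (term_subst v t) x = Defs.eval E t (fun i => Defs.eval E (v i) x).
Proof.
by elim: t => //= l f ts IH; congr fun_int; apply/funext => i; exact: IH.
Qed.

Lemma sat_subst n (phi : formula S M n) k (v : 'I_n -> term S M k) x :
  sat E (formula_subst phi v) x = sat E phi (fun i => Defs.eval E (v i) x).
Proof.
elim: phi k v x => //= [{}n t u|{}n t u|{}n l r ts|{}n p IH|{}n p IH q IHq|{}n p IH] k v x.
- by rewrite !eval_subst.
- by rewrite !eval_subst.
- by congr rel_int; apply/funext => i; rewrite eval_subst.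
- by rewrite IH.
- by rewrite IH IHq.
- apply: eq_exists => y; rewrite IH; congr sat; apply/funext => i.
  rewrite /term_lift /snoc; case: unliftP => [j _|_]; last by rewrite /= unlift_none.
  by rewrite eval_subst; congr Defs.eval; apply/funext => l /=; rewrite liftK.
Qed.

Definition term_fun n (t : ('I_n -> M) -> M) :=
  exists u : term S M n, forall x, Defs.eval E u x = t x.

(* Stated for predicates, so that it can be proved by following their syntax. *)
Definition dfn n (P : ('I_n -> M) -> Prop) :=
  exists phi : formula S M n, forall x, sat E phi x = P x.

Lemma dfnP n (X : set {ptws 'I_n -> M}) : definable E X <-> dfn X.
Proof.
split=> [[phi ->]|[phi e]]; exists phi => //.
by apply/funext => x; rewrite -e.
Qed.

Lemma term_var n (i : 'I_n) : term_fun (fun x => x i).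
Proof. by exists (Var S M i). Qed.

Lemma term_cst n (a : M) : term_fun (fun _ : 'I_n -> M => a).
Proof. by exists (Par S n a). Qed.

Lemma term_snoc n k (v : ('I_n -> M) -> 'I_k -> M) (t : ('I_n -> M) -> M) i :
  (forall j, term_fun (fun x => v x j)) -> term_fun t ->
  term_fun (fun x => snoc (v x) (t x) i).
Proof. by move=> dv dt; rewrite /snoc; case: unlift. Qed.

Lemma term_cat n k l (v : ('I_n -> M) -> 'I_k -> M) (w : ('I_n -> M) -> 'I_l -> M) i :
  (forall j, term_fun (fun x => v x j)) -> (forall j, term_fun (fun x => w x j)) ->
  term_fun (fun x => cat_pt (v x) (w x) i).
Proof. by move=> dv dw; rewrite /cat_pt; case: fintype.split. Qed.

Lemma dfn_subst n k (P : ('I_k -> M) -> Prop) (v : ('I_n -> M) -> 'I_k -> M) :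
  dfn P -> (forall j, term_fun (fun x => v x j)) -> dfn (fun x => P (v x)).
Proof.
move=> [phi e] /choice[u uE]; exists (formula_subst phi u) => x.
by rewrite sat_subst e; congr P; apply/funext => i; rewrite uE.
Qed.

Lemma dfn_ext n (P Q : ('I_n -> M) -> Prop) : (forall x, P x <-> Q x) -> dfn P -> dfn Q.
Proof. by move=> PQ [phi e]; exists phi => x; rewrite e; apply/propext. Qed.

Lemma dfn_not n (P : ('I_n -> M) -> Prop) : dfn P -> dfn (fun x => ~ P x).
Proof. by move=> [phi e]; exists (Neg phi) => x /=; rewrite e. Qed.

Lemma dfn_and n (P Q : ('I_n -> M) -> Prop) : dfn P -> dfn Q -> dfn (fun x => P x /\ Q x).
Proof. by move=> [phi e] [psi f]; exists (Conj phi psi) => x /=; rewrite e f. Qed.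

Lemma dfn_true n : dfn (fun _ : 'I_n -> M => True).
Proof.
(* A closed formula, which also serves when [n] is 0. *)
pose phi : formula S M n := Exists (Eq (Var S M ord_max) (Var S M ord_max)).
exists (Neg (Conj phi (Neg phi))) => x; apply/propext; split => // _ [p np].
exact: np.
Qed.

(** By excluded middle the predicate is constantly true or constantly false. This absorbs side
    conditions such as injectivity of a choice of coordinates. *)
Lemma dfn_prop n (P : Prop) : dfn (fun _ : 'I_n -> M => P).
Proof.
have [p|np] := pselect P; first by apply: dfn_ext (dfn_true n) => x.
by apply: dfn_ext (dfn_not (dfn_true n)) => x; split=> // /(_ I).
Qed.

Lemma dfn_or n (P Q : ('I_n -> M) -> Prop) : dfn P -> dfn Q -> dfn (fun x => P x \/ Q x).
Proof.
move=> dP dQ; apply: dfn_ext (dfn_not (dfn_and (dfn_not dP) (dfn_not dQ))) => x.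
by split=> [/not_andP[]/contrapT|[p|q] []]; [left|right| |].
Qed.

Lemma dfn_imp n (P Q : ('I_n -> M) -> Prop) : dfn P -> dfn Q -> dfn (fun x => P x -> Q x).
Proof.
move=> dP dQ; apply: dfn_ext (dfn_or (dfn_not dP) dQ) => x.
split=> [[np //|//]|pq]; have [p|np] := pselect (P x); [by right; exact: pq|by left].
Qed.

Lemma dfn_iff n (P Q : ('I_n -> M) -> Prop) : dfn P -> dfn Q -> dfn (fun x => P x <-> Q x).
Proof. by move=> dP dQ; apply: dfn_and; apply: dfn_imp. Qed.

Lemma dfn_lt n (t u : ('I_n -> M) -> M) :
  term_fun t -> term_fun u -> dfn (fun x => t x < u x).
Proof. by move=> [p e] [q f]; exists (Lt p q) => x /=; rewrite e f. Qed.

Lemma dfn_eq n (t u : ('I_n -> M) -> M) :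
  term_fun t -> term_fun u -> dfn (fun x => t x = u x).
Proof. by move=> [p e] [q f]; exists (Eq p q) => x /=; rewrite e f. Qed.

Lemma dfn_le n (t u : ('I_n -> M) -> M) :
  term_fun t -> term_fun u -> dfn (fun x => t x <= u x).
Proof.
move=> dt du; apply: dfn_ext (dfn_not (dfn_lt du dt)) => x.
by rewrite leNgt; split => /negP.
Qed.

Lemma dfn_ex n (P : ('I_n -> M) -> M -> Prop) :
  dfn (fun z : 'I_n.+1 -> M => P (init z) (final z)) -> dfn (fun x => exists y, P x y).
Proof.
move=> [phi e]; exists (Exists phi) => x /=; apply: eq_exists => y.
by rewrite e init_snoc final_snoc.
Qed.

Lemma dfn_all n (P : ('I_n -> M) -> M -> Prop) :
  dfn (fun z : 'I_n.+1 -> M => P (init z) (final z)) -> dfn (fun x => forall y, P x y).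
Proof.
move=> /dfn_not /(dfn_ex (P := fun x y => ~ P x y)) /dfn_not.
by apply: dfn_ext => x; split=> [/forallNP np y|p [y] /(_ (p y))//]; exact: contrapT (np y).
Qed.

(** Boxes are given by pairs of points, so formulas must quantify over tuples; the tuple is peeled
    coordinate by coordinate, the last one outermost. *)
Lemma dfn_exv n k (P : ('I_n -> M) -> ('I_k -> M) -> Prop) :
  dfn (fun z : 'I_(n + k) -> M => P (lpart z) (rpart z)) ->
  dfn (fun x => exists y : 'I_k -> M, P x y).
Proof.
elim: k n P => [|k IH] n P dP.
  have dv (y0 : 'I_0 -> M) j : term_fun (fun x : 'I_n -> M => cat_pt x y0 j).
    by apply: term_cat => [i|[]//]; exact: term_var.
  apply: dfn_ext (dfn_subst dP (dv (@from_ord0 M))) => x.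
  rewrite lpart_cat rpart_cat; split=> [p|[y]]; first by eexists; exact: p.
  by congr P; apply/funext => -[].
apply: (@dfn_ext _ (fun x => exists y, exists v : 'I_k -> M, P x (snoc v y))).
  move=> x; split=> [[y [v p]]|[y p]]; first by exists (snoc v y).
  by exists (final y), (init y); rewrite snoc_eta.
apply/dfn_ex/IH.
(* Regroups the coordinates: the variable already quantified moves from the end of the parameters to
   the end of the tuple. *)
pose v (z : 'I_(n.+1 + k) -> M) : 'I_(n + k.+1) -> M :=
  cat_pt (init (lpart z)) (snoc (rpart z) (final (lpart z))).
have dv j : term_fun (fun z => v z j).
  apply: term_cat => [i|i]; first exact: term_var.
  apply: term_snoc => [l|]; exact: term_var.
by apply: dfn_ext (dfn_subst dP dv) => x; rewrite lpart_cat rpart_cat.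
Qed.

Lemma dfn_allv n k (P : ('I_n -> M) -> ('I_k -> M) -> Prop) :
  dfn (fun z : 'I_(n + k) -> M => P (lpart z) (rpart z)) ->
  dfn (fun x => forall y : 'I_k -> M, P x y).
Proof.
move=> /dfn_not /(dfn_exv (P := fun x y => ~ P x y)) /dfn_not.
by apply: dfn_ext => x; split=> [/forallNP np y|p [y] /(_ (p y))//]; exact: contrapT (np y).
Qed.

Lemma dfn_all_fin n (T : finType) (P : T -> ('I_n -> M) -> Prop) :
  (forall i, dfn (P i)) -> dfn (fun x => forall i, P i x).
Proof.
move=> dP.
have H (s : seq T) : dfn (fun x => forall i, i \in s -> P i x).
  elim: s => [|i s IH]; first by apply: dfn_ext (dfn_true n) => x; split.
  apply: dfn_ext (dfn_and (dP i) IH) => x; split=> [[p q] j|p].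
    by rewrite inE => /orP[/eqP -> //|/q].
  by split=> [|j js]; apply: p; rewrite inE ?eqxx // js orbT.
by apply: dfn_ext (H (enum T)) => x; split=> p i // ; apply: p; rewrite mem_enum.
Qed.

Lemma dfn_ex_fin n (T : finType) (P : T -> ('I_n -> M) -> Prop) :
  (forall i, dfn (P i)) -> dfn (fun x => exists i, P i x).
Proof.
move=> dP; have := dfn_not (dfn_all_fin (fun i => dfn_not (dP i))).
by apply: dfn_ext => x; split=> [/existsNP[i /contrapT]|[i p] /(_ i)]; [exists i|].
Qed.

Lemma dfn_and3 n (P Q R : ('I_n -> M) -> Prop) :
  dfn P -> dfn Q -> dfn R -> dfn (fun x => [/\ P x, Q x & R x]).
Proof.
move=> dP dQ dR; apply: dfn_ext (dfn_and dP (dfn_and dQ dR)) => x.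
by split=> [[p [q r]]|[p q r]].
Qed.

Lemma dfn_andb n (b c : ('I_n -> M) -> bool) :
  dfn (fun x => b x) -> dfn (fun x => c x) -> dfn (fun x => b x && c x).
Proof.
by move=> db dc; apply: dfn_ext (dfn_and db dc) => x; split=> [[-> ->]|/andP].
Qed.

End Definability.

Ltac dterm := solve
  [ exact: term_var | exact: term_cst
  | apply: term_snoc => [?|]; dterm | apply: term_cat => ?; dterm | eassumption ].

(** Follows the syntax of a predicate down to equalities, order relations and definable sets of the
    context, the latter composed with a substitution. *)
Ltac dfn_tac := rewrite /mkset /=; cbv beta;
  lazymatch goal with
  | |- dfn _ (fun x => _ /\ _) => apply: dfn_and; dfn_tac
  | |- dfn _ (fun x => and3 _ _ _) => apply: dfn_and3; dfn_tac
  | |- dfn _ (fun x => _ \/ _) => apply: dfn_or; dfn_tac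
  | |- dfn _ (fun x => ~ _) => apply: dfn_not; dfn_tac
  | |- dfn _ (fun x => _ <-> _) => apply: dfn_iff; dfn_tac
  | |- dfn _ (fun x => is_true (andb _ _)) => apply: dfn_andb; dfn_tac
  | |- dfn _ (fun x => is_true (_ < _)) => apply: dfn_lt; dterm
  | |- dfn _ (fun x => is_true (_ <= _)) => apply: dfn_le; dterm
  | |- dfn _ _ =>
    first
    [ exact: dfn_prop
    | match goal with
      | H : dfn _ ?X |- dfn _ (fun z => ?X (@?v z)) =>
          apply: (dfn_subst (v := v) H) => ?; dterm
      end
    | apply: dfn_eq; dterm
    | apply: dfn_ex; dfn_tac | apply: dfn_all; dfn_tac
    | apply: dfn_exv; dfn_tac | apply: dfn_allv; dfn_tac
    | apply: dfn_all_fin => ?; dfn_tac | apply: dfn_ex_fin => ?; dfn_tac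
    | apply: dfn_imp; dfn_tac
    | idtac ]
  end.

(** * Boxes and germs at definable cuts *)

Section Boxes.
Context d (M : orderTopologicalType d) (dM : dense_without_endpoints M).

Definition box n (a b : 'I_n -> M) : set {ptws 'I_n -> M} :=
  [set x | forall i, a i < x i < b i].

Definition big n (A : set {ptws 'I_n -> M}) : Prop := exists x : {ptws 'I_n -> M}, nbhs x A.

Lemma dense_between (x y : M) : x < y -> exists z, x < z < y.
Proof. by case: dM => _ + _ _; exact. Qed.

Lemma below (x : M) : exists y, y < x.
Proof. by case: dM. Qed.

Lemma above (x : M) : exists y, x < y.
Proof. by case: dM. Qed.

(** Without endpoints, unbounded intervals shrink to bounded ones, so a neighbourhood is witnessed
    by two elements, over which a formula can quantify. *)
Lemma nbhs_itvP (x : M) (A : set M) :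
  nbhs x A <-> exists p q, p < x < q /\ forall z, p < z < q -> A z.
Proof.
rewrite itv_nbhsE; split; last first.
  move=> [p [q [pxq A_]]]; exists `]p, q[%O; first by split; rewrite ?in_itv.
  by move=> z /=; rewrite in_itv => /A_.
have [p px] := below x; have [q xq] := above x.
move=> [[[[]l|[]] [[]r|[]]]] [] //; rewrite in_itv /= => _ h A_.
- exists l, r; split=> // z zlr; apply: A_; by rewrite /= in_itv.
- move: h; rewrite andbT => h; exists l, q; rewrite h xq; split=> // z /andP[lz _].
  by apply: A_; rewrite /= in_itv /= lz.
- exists p, r; rewrite px h; split=> // z /andP[_ zr].
  by apply: A_; rewrite /= in_itv /= zr.
- exists p, q; rewrite px xq; split=> // z _; exact: A_.
Qed.

Lemma near_coord n (x : {ptws 'I_n -> M}) i (A : set M) :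
  nbhs (x i) A -> nbhs x [set y : {ptws 'I_n -> M} | A (y i)].
Proof. exact: (@proj_continuous 'I_n (fun=> M) i x). Qed.

Lemma near_gt n (x : {ptws 'I_n -> M}) i (c : M) :
  c < x i -> nbhs x [set y : {ptws 'I_n -> M} | c < y i].
Proof.
move=> cx; apply: (@near_coord n x i (fun y => c < y)); have [q xq] := above (x i).
by apply/nbhs_itvP; exists c, q; rewrite cx xq; split=> // z /andP[].
Qed.

Lemma near_lt n (x : {ptws 'I_n -> M}) i (c : M) :
  x i < c -> nbhs x [set y : {ptws 'I_n -> M} | y i < c].
Proof.
move=> cx; apply: (@near_coord n x i (fun y => y < c)); have [q xq] := below (x i).
by apply/nbhs_itvP; exists q, c; rewrite cx xq; split=> // z /andP[].
Qed.

Lemma near_itv n (x : {ptws 'I_n -> M}) i (c e : M) :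
  c < x i < e -> nbhs x [set y : {ptws 'I_n -> M} | c < y i < e].
Proof.
move=> /andP[/near_gt cx /near_lt xe].
by apply: filterS2 cx xe => y /= -> ->.
Qed.

Lemma near_subset n (x : {ptws 'I_n -> M}) (A B : set {ptws 'I_n -> M}) :
  A `<=` B -> nbhs x A -> nbhs x B.
Proof. by move=> AB; apply: filterS. Qed.

Lemma near_all n (x : {ptws 'I_n -> M}) (T : finType) (f : T -> set {ptws 'I_n -> M}) :
  (forall i, nbhs x (f i)) -> nbhs x [set y | forall i, f i y].
Proof. by move=> xf; apply: (filter_forall (F := nbhs x)). Qed.

Lemma nbhs_box n (a b : 'I_n -> M) x : box a b x -> nbhs x (box a b).
Proof.
move=> abx; apply: (near_all (f := fun i y => a i < y i < b i)) => i.
exact: (near_itv (abx i)).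
Qed.

(** The boxes containing [x] generate a filter that converges to [x] in every coordinate, hence in
    the product topology, so it contains every neighbourhood of [x]. *)
Lemma nbhs_boxP n (x : {ptws 'I_n -> M}) A :
  nbhs x A <-> exists a b, box a b x /\ box a b `<=` A.
Proof.
split; last by move=> [a [b [/nbhs_box abx abA]]]; exact: filterS abA abx.
pose D : set (('I_n -> M) * ('I_n -> M)) := [set ab | box ab.1 ab.2 x].
pose F := filter_from D (fun ab => box ab.1 ab.2).
have [u ux] := choice (fun i => below (x i)).
have [v xv] := choice (fun i => above (x i)).
have FF : Filter F.
  apply: filter_from_filter; first by exists (u, v) => i /=; rewrite ux xv.
  move=> [a b] [a' b'] abx abx'.
  exists (fun i => Order.max (a i) (a' i), fun i => Order.min (b i) (b' i)).
    move=> i /=; rewrite gt_max lt_min; have /andP[-> ->] := abx i.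
    by have /andP[-> ->] := abx' i.
  move=> z zP; split=> i; have := zP i; rewrite /= gt_max lt_min.
    by move=> /andP[/andP[-> _] /andP[]].
  by move=> /andP[/andP[_ ->] /andP[]].
have /(_ A) : F --> (x : product_topology_def (fun _ : 'I_n => M)).
  apply/cvg_sup => i B; rewrite nbhsE => -[U [[V oV <-] /= Vx] VB].
  have /nbhs_itvP[p [q [/andP[px xq] pqV]]] : nbhs (x i) V by exact: open_nbhs_nbhs.
  exists (fun j => if j == i then p else u j, fun j => if j == i then q else v j).
    by move=> j /=; case: eqP => [->|_]; rewrite ?px // ux xv.
  by move=> z /(_ i) /=; rewrite eqxx => zi; apply/VB/pqV.
by move=> h /h[[a b] abx abA]; exists a, b.
Qed.

Lemma near_comp n k (s : 'I_k -> 'I_n) (x : {ptws 'I_n -> M}) (U : set {ptws 'I_k -> M}) :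
  nbhs (x \o s : {ptws 'I_k -> M}) U -> nbhs x [set y : {ptws 'I_n -> M} | U (y \o s)].
Proof.
move=> /nbhs_boxP[a [b [abx abU]]].
apply: (@filterS _ _ _ [set y : {ptws 'I_n -> M} | forall i, a i < y (s i) < b i]).
  by move=> y yab; exact: abU.
apply: (near_all (f := fun i y => a i < y (s i) < b i)) => i.
by apply: near_itv; exact: abx.
Qed.

Lemma near_snoc n (x : {ptws 'I_n -> M}) (y p q : M) (U : set {ptws 'I_n -> M}) :
  nbhs x U -> p < y < q ->
  nbhs (snoc x y : {ptws 'I_n.+1 -> M}) [set z | U (init z) /\ p < final z < q].
Proof.
move=> Ux pyq; have e : snoc x y \o lift ord_max = x := init_snoc x y.
have H1 : nbhs (snoc x y : {ptws 'I_n.+1 -> M})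
    [set z : {ptws 'I_n.+1 -> M} | U (z \o lift ord_max)].
  by apply: near_comp; rewrite e.
have H2 : nbhs (snoc x y : {ptws 'I_n.+1 -> M})
    [set z : {ptws 'I_n.+1 -> M} | p < z ord_max < q].
  by apply: near_itv; rewrite snoc_max.
exact: filterI H1 H2.
Qed.

Lemma near_unsnoc n (z : {ptws 'I_n.+1 -> M}) A : nbhs z A ->
  exists U p q, [/\ nbhs (init z : {ptws 'I_n -> M}) U, p < final z < q &
    forall u y, U u -> p < y < q -> A (snoc u y)].
Proof.
move=> /nbhs_boxP[a [b [abz abA]]]; exists (box (init a) (init b)), (final a), (final b).
split; [by apply: nbhs_box => i; exact: abz|exact: abz|] => u y abu py.
apply: abA => i; case: (unliftP ord_max i) => [j ->|->]; last by rewrite snoc_max.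
by rewrite snoc_lift; exact: abu.
Qed.

Lemma big_subset n (A B : set {ptws 'I_n -> M}) : A `<=` B -> big A -> big B.
Proof. by move=> AB [x xA]; exists x; exact: filterS xA. Qed.

Lemma open_box_open n (B : set {ptws 'I_n -> M}) : open_box B -> open B.
Proof.
move=> [I [oI ->]]; rewrite openE => x xI; rewrite /interior.
apply: (near_all (f := fun i y => y i \in I i)) => i.
apply: (@near_coord _ _ _ (fun y => y \in I i)).
apply: open_nbhs_nbhs; split; last exact: xI.
exact: itv_open_ends_open.
Qed.

Lemma box_open_box n (a b : 'I_n -> M) : open_box (box a b).
Proof.
exists (fun i => `]a i, b i[%O); split; first by [].
by apply/seteqP; split=> x xab i; have := xab i; rewrite in_itv.
Qed.

End Boxes.

(** * Right germs at definable cuts *)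

Section Germs.
Context (S : signature) d (M : orderTopologicalType d) (E : expansion S M).
Context (dM : dense_without_endpoints M) (lM : star_locally_weakly_o_minimal E).

Lemma lt_Elt (x y : M) : ((Elt E x : completion E) < Elt E y) = (x < y).
Proof. by rewrite !lt_def; congr (~~ _ && _); apply/eqP/eqP => [[]//|->]. Qed.

Lemma lt_EltGap (x : M) (g : gap E) : ((Elt E x : completion E) < Gap g) = `[< lower g x >].
Proof. by rewrite lt_def (_ : (_ != _)); last exact/eqP. Qed.

Lemma lt_GapElt (x : M) (g : gap E) : ((Gap g : completion E) < Elt E x) = `[< upper g x >].
Proof. by rewrite lt_def (_ : (_ != _)); last exact/eqP. Qed.

(* The lower parts of the points of the completion: either [L] has a maximum, or [L]
   and its complement form a definable gap. *)
Record cut (L : set M) : Prop := Cut {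
  cut_def : definable1 E L;
  cut_lower : L !=set0;
  cut_upper : exists y, ~ L y;
  cut_le : forall a b, a <= b -> L b -> L a;
  cut_nomin : forall b, ~ L b -> exists2 a, ~ L a & a < b }.

(** The right neighbourhoods of the cut, in a form that treats elements and gaps alike. *)
Definition right_germ (L : set M) : set_system M :=
  filter_from [set y | ~ L y] (fun y => [set z | ~ L z /\ z < y]).

Lemma right_germ_filter L : cut L -> Filter (right_germ L).
Proof.
move=> [_ _ [y Ly] _ _]; apply: filter_from_filter; first by exists y.
move=> a b La Lb; have [ab|/ltW ba] := leP a b; [exists a|exists b] => // z [Lz zl].
  by split; split=> //; exact: lt_le_trans ab.
by split; split=> //; exact: lt_le_trans ba.
Qed.

(** The cut determines a point of the completion, the maximum of [L] or else the gap between [L] and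
    its complement; every open interval around this point contains a right neighbourhood of the
    cut. *)
Lemma cut_local L X : cut L -> definable1 E X ->
  exists (F : set M) (k : nat) (C : 'I_k -> set M),
  [/\ finite_set F, forall j, order_convex (C j) &
      right_germ L [set z | X z <-> F z \/ exists j, C j z]].
Proof.
move=> [dL [l0 Ll0] [u0 Lu0] Lle Lnm] dX.
suff [a aP] : exists a : completion E, forall I : interval M, itv_open_ends I ->
    a \in map_itv (@Elt S d M E) I -> right_germ L [set` I].
  have [I [oI aI [F [k [C [fF oC XI]]]]]] := lM a dX.
  exists F, k, C; split=> // [j|]; first by case: (oC j).
  have XIz z : (X z /\ z \in I) = (F z \/ exists2 j, True & C j z) := congr1 (@^~ z) XI.
  have [y Ly yI] := aP I oI aI; exists y => // z /yI Iz /=; split=> [Xz|FCz].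
    have : X z /\ z \in I by [].
    by rewrite XIz => -[|[j _]]; [left|right; exists j].
  suff [] : X z /\ z \in I by [].
  by rewrite XIz; case: FCz => [|[j]]; [left|right; exists j].
have Lge a b : L a -> ~ L b -> a < b.
  by move=> La Lb; rewrite ltNge; apply/negP => /Lle /(_ La).
have [[a La amax]|nomax] := pselect (exists2 a, L a & forall b, L b -> b <= a).
  exists (Elt E a) => -[[[]l|[]] [[]r|[]]] //= _; rewrite in_itv /= ?lt_Elt ?andbT.
  - move=> /andP[la ar]; exists r => [/amax|z [Lz zr]]; first by rewrite leNgt ar.
    by rewrite /= in_itv /= zr (lt_trans la (Lge _ _ La Lz)).
  - move=> la; exists u0 => // z [Lz _].
    by rewrite /= in_itv /= andbT (lt_trans la (Lge _ _ La Lz)).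
  - move=> ar; exists r => [/amax|z [Lz zr]]; first by rewrite leNgt ar.
    by rewrite /= in_itv.
  - by exists u0.
have dU : definable1 E (~` L) by apply/dfnP/dfn_not/dfnP.
have Lnomax a : L a -> exists2 b, L b & a < b.
  move=> La; apply: contrapT => h; apply: nomax; exists a => // b Lb.
  by rewrite leNgt; apply/negP => ab; apply: h; exists b.
pose g : gap E := MkGap dL dU (ex_intro _ l0 Ll0) (ex_intro _ u0 Lu0) (setUv L) Lge Lnomax Lnm.
exists (Gap g) => -[[[]l|[]] [[]r|[]]] //= _; rewrite in_itv /= ?lt_EltGap ?lt_GapElt.
- move=> /andP[/asboolP Ll /asboolP Lr]; exists r => // z [Lz zr].
  by rewrite /= in_itv /= zr Lge.
- by move=> /andP[/asboolP Ll _]; exists u0 => // z [Lz zr]; rewrite /= in_itv /= andbT Lge.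
- by move=> /asboolP Lr; exists r => // z [Lz zr]; rewrite /= in_itv.
- by exists u0.
Qed.

(** A finite set misses some right neighbourhood of the cut, and a convex set meeting all of them
    contains one. So no definable set oscillates at a cut. *)
Lemma cut_germ L X : cut L -> definable1 E X ->
  right_germ L X \/ right_germ L (~` X).
Proof.
move=> cL dX; have [F [k [C [/finite_seqP[s ->] cC XE]]]] := cut_local cL dX.
have FL := right_germ_filter cL; have [_ _ [u0 Lu0] Lle Lnm] := cL.
have sF : right_germ L [set z | z \notin s].
  elim: s {XE} => [|p s IH]; first by exists u0.
  have pL : right_germ L [set z | z != p].
    have [Lp|Lp] := pselect (L p); last by exists p => // z [_ zp] /=; rewrite lt_eqF.
    by exists u0 => // z [Lz _] /=; apply/eqP => zp; apply: Lz; rewrite zp.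
  by apply: filterS2 pL IH => z /= zp zs; rewrite inE negb_or zp.
have CL j : right_germ L (C j) \/ right_germ L (~` C j).
  have [[y Ly yC]|h] := pselect (exists2 y, ~ L y & forall z, ~ L z -> z < y -> ~ C j z).
    by right; exists y => // z [Lz zy]; exact: yC.
  have H y : ~ L y -> exists z, [/\ ~ L z, z < y & C j z].
    move=> Ly; apply: contrapT => h'; apply: h; exists y => // z Lz zy Cz.
    by apply: h'; exists z.
  have [y [Ly _ Cy]] := H _ Lu0; left; exists y => // z [Lz zy].
  have [w [_ wz Cw]] := H _ Lz; apply: (cC j w y z) => //.
  by rewrite !ltW.
have [[j jL]|nL] := pselect (exists j, right_germ L (C j)).
  by left; apply: filterS2 XE jL => z /= XEz Cz; apply/XEz; right; exists j.
right; have : right_germ L [set z | forall j, ~ C j z].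
  apply: (filter_forall (F := right_germ L)) => j; case: (CL j) => // Lj.
  by case: nL; exists j.
move=> sC; apply: filterS3 XE sF sC => z /= XEz /negP zs zC Xz.
by case/XEz: Xz => [//|[j /zC]].
Qed.

Definition no_interior (X : set M) : Prop := forall p q, p < q -> exists2 z, p < z < q & ~ X z.

(** The complement of [L] has no minimum, so a right neighbourhood of the cut contains an interval;
    this excludes the first case of [cut_germ]. *)
Lemma no_interior_cut L X : cut L -> definable1 E X -> no_interior X -> right_germ L (~` X).
Proof.
move=> cL dX nX; have [[y Ly yX]|//] := cut_germ cL dX.
have [x Lx xy] := cut_nomin cL Ly; have [z /andP[xz zy] []] := nX _ _ xy.
apply: yX; split=> //; apply: contra_not Lx; exact/(cut_le cL)/ltW.
Qed.

Lemma lower_bounds_cut X c : definable1 E X -> X !=set0 -> (forall x, X x -> c <= x) ->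
  cut [set y | forall x, X x -> y <= x].
Proof.
move=> /dfnP dX [x0 Xx0] cX; split.
- apply/dfnP; apply: dfn_all; apply: dfn_imp; last by apply: dfn_le; exact: term_var.
  by apply: (dfn_subst (v := fun z _ => final z) dX) => j; exact: term_var.
- by exists c.
- have [y xy] := above dM x0; exists y => /(_ _ Xx0).
  by rewrite leNgt xy.
- by move=> a b ab Lb x /Lb; exact: le_trans.
- move=> b /existsNP[x /not_implyP[Xx /negP]]; rewrite -ltNge => xb.
  have [z /andP[xz zb]] := dense_between dM xb; exists z => // /(_ _ Xx).
  by rewrite leNgt xz.
Qed.

(** [X] avoids a right neighbourhood of the cut of its lower bounds, so an element of [X] below the
    end of that neighbourhood is itself a lower bound. *)
Lemma no_interior_min X c : definable1 E X -> no_interior X -> X !=set0 ->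
  (forall x, X x -> c <= x) -> exists2 m, X m & forall x, X x -> m <= x.
Proof.
move=> dX nX X0 cX; have cL := lower_bounds_cut dX X0 cX.
have [y Ly yX] := no_interior_cut cL dX nX.
move: Ly => /existsNP[x /not_implyP[Xx /negP]]; rewrite -ltNge => xy.
exists x => //; apply: contrapT => Lx; exact: (yX x).
Qed.

(** Near [a], [X] consists of a finite set and open convex sets; the latter are empty, since a point
    in one of them would give an interval inside [X]. *)
Lemma no_interior_isolated X a : definable1 E X -> no_interior X ->
  exists b c, b < a < c /\ forall z, b < z < c -> X z -> z = a.
Proof.
move=> dX nX; suff : nbhs a [set z | X z -> z = a].
  by move=> /(nbhs_itvP dM)[p [q [pq h]]]; exists p, q.
have [I [oI aI [F [k [C [/finite_seqP[s ->] oC XI]]]]]] := lM (Elt E a) dX.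
have XIz z : (X z /\ z \in I) = (z \in s \/ exists2 j, True & C j z) := congr1 (@^~ z) XI.
have Ia : nbhs a [set` I].
  apply: open_nbhs_nbhs; split; first exact: itv_open_ends_open.
  by move: I {oI XI XIz} aI => [[[]l|[]] [[]r|[]]] /=; rewrite !in_itv /= ?lt_Elt.
have C0 j z : X z -> ~ C j z.
  move=> Xz Cz; have [/[dup] oCj + _] := oC j; rewrite openE => /(_ _ Cz).
  move=> /(nbhs_itvP dM)[p [q [/andP[pz zq] pqC]]].
  have [w pwq []] := nX _ _ (lt_trans pz zq).
  suff [] : X w /\ w \in I by [].
  by rewrite XIz; right; exists j => //; exact: pqC.
have sa : nbhs a [set z | z \in s -> z = a].
  elim: s {XI XIz} => [|p s IH]; first by near=> z.
  have pa : nbhs a [set z | z = p -> z = a].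
    have [->|ap] := eqVneq p a; first by near=> z.
    have [b ba] := below dM a; have [c ac] := above dM a.
    case/lt_total/orP: ap => pa; apply/(nbhs_itvP dM).
      by exists p, c; rewrite pa ac; split=> // z /andP[+ _] zp; rewrite zp ltxx.
    by exists b, p; rewrite pa ba; split=> // z /andP[_ +] zp; rewrite zp ltxx.
  by apply: filterS2 pa IH => z /= zp zs; rewrite inE => /orP[/eqP/zp|/zs].
apply: filterS2 Ia sa => z /= Iz zs Xz.
have : X z /\ z \in I by [].
by rewrite XIz => -[/zs//|[j _ /(C0 _ _ Xz)]].
Unshelve. all: by end_near. Qed.

End Germs.

(** * Generic continuity of suprema *)

Section Suprema.
Context (S : signature) d (M : orderTopologicalType d) (E : expansion S M).
Context (dM : dense_without_endpoints M).

Lemma le_Elt (x y : M) : ((Elt E x : completion E) <= Elt E y) = (x <= y).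
Proof. by []. Qed.

(** With [L] the downward closure of [A], the supremum is the maximum of [L], or the minimum of its
    complement, or, when neither exists, the gap they form. *)
Lemma sup_exists (A : set M) b : definable1 E A -> A !=set0 -> (forall x, A x -> x <= b) ->
  exists s : completion E, supremums [set Elt E y | y in A] s.
Proof.
move=> /dfnP dA [x0 Ax0] Ab; pose L := [set x | exists y, A y /\ x <= y].
have dL : definable1 E L.
  apply/dfnP; apply: dfn_ex; apply: dfn_and; last by apply: dfn_le; exact: term_var.
  by apply: (dfn_subst (v := fun z _ => final z) dA) => j; exact: term_var.
have AL x : A x -> L x by exists x.
have Lle x y : x <= y -> L y -> L x.
  by move=> xy [z [Az yz]]; exists z; rewrite (le_trans xy).
have [[a [y [Ay ay]] amax]|nomax] := pselect (exists2 a, L a & forall b, L b -> b <= a).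
  exists (Elt E a); split=> [_ [x Ax <-]|t tub]; first by rewrite le_Elt; exact/amax/AL.
  apply: (@le_trans _ _ (Elt E y)); first by rewrite le_Elt.
  by apply: tub; exists y.
have Lnomax a : L a -> exists2 b, L b & a < b.
  move=> La; apply: contrapT => h; apply: nomax; exists a => // c Lc.
  by rewrite leNgt; apply/negP => ac; apply: h; exists c.
have ubL c : (forall y, A y -> y <= c) -> ~ L c.
  move=> cub /Lnomax[e [y [Ay ey]] ce].
  by have := lt_le_trans ce (le_trans ey (cub _ Ay)); rewrite ltxx.
have [[m Lm mmin]|nomin] := pselect (exists2 a, ~ L a & forall b, ~ L b -> a <= b).
  exists (Elt E m); split=> [_ [x Ax <-]|[c tub|h tub]].
  - rewrite le_Elt leNgt; apply/negP => /ltW mx.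
    exact/Lm/(Lle _ _ mx)/AL.
  - by rewrite le_Elt; apply/mmin/ubL => y Ay; rewrite -le_Elt; apply: tub; exists y.
  - apply/asboolP; apply: contrapT => /upperP /upper_nomin[c uc cm].
    have [y [Ay cy]] : L c by apply: contrapT => /mmin; rewrite leNgt cm.
    have /asboolP ly : (Elt E y : completion E) <= Gap h by apply: tub; exists y.
    by move/upperP: uc; apply; exact: lower_le ly.
have dU : definable1 E (~` L) by apply/dfnP/dfn_not/dfnP.
have Lge x y : L x -> ~ L y -> x < y.
  by move=> Lx Ly; rewrite ltNge; apply/negP => /Lle /(_ Lx).
have Unomin y : ~ L y -> exists2 x, ~ L x & x < y.
  move=> Ly; apply: contrapT => h; apply: nomin; exists y => // x Lx.
  by rewrite leNgt; apply/negP => xy; apply: h; exists x.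
pose g : gap E := MkGap dL dU (ex_intro _ x0 (AL _ Ax0)) (ex_intro _ b (ubL _ Ab))
  (setUv L) Lge Lnomax Unomin.
exists (Gap g); split=> [_ [x Ax <-]|[c tub|h tub]].
- by apply/asboolP/(AL x).
- by apply/asboolP/ubL => y Ay; rewrite -le_Elt; apply: tub; exists y.
- apply/asboolP => x [y [Ay xy]].
  have /asboolP ly : (Elt E y : completion E) <= Gap h by apply: tub; exists y.
  exact: lower_le ly.
Qed.

Lemma lt_sup (A : set M) (s : completion E) c : supremums [set Elt E y | y in A] s ->
  (Elt E c < s) <-> exists y, A y /\ c < y.
Proof.
move=> [sub slb]; split=> [cs|[y [Ay cy]]].
  apply: contrapT => h; suff : s <= Elt E c by rewrite leNgt cs.
  apply: slb => _ [y Ay <-]; rewrite le_Elt leNgt; apply/negP => cy.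
  by apply: h; exists y.
by apply: (@lt_le_trans _ _ (Elt E y)); [rewrite lt_Elt|apply: sub; exists y].
Qed.

(** The witness [b] is the supremum itself or, if that is a gap, an element of its upper part, which
    has no minimum. Together with [lt_sup] this makes comparisons with suprema first-order. *)
Lemma sup_lt (A : set M) (s : completion E) c : supremums [set Elt E y | y in A] s ->
  (s < Elt E c) <-> exists b, b < c /\ forall y, A y -> y <= b.
Proof.
move=> [sub slb]; split=> [sc|[b [bc Ab]]]; last first.
  apply: (@le_lt_trans _ _ (Elt E b)); last by rewrite lt_Elt.
  by apply: slb => _ [y Ay <-]; rewrite le_Elt; exact: Ab.
case: s sc sub slb => [a|g]; first rewrite lt_Elt => ac sub _.
  exists a; split=> // y Ay; rewrite -le_Elt; apply: sub; by exists y.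
rewrite lt_GapElt => /asboolP/upper_nomin[b ub bc] sub _.
exists b; split=> // y Ay; apply/ltW; apply: gap_lt ub.
have /asboolP// : (Elt E y : completion E) <= Gap g by apply: sub; exists y.
Qed.

End Suprema.

(** * Continuity of suprema of fibers *)

Section Fibres.
Context (S : signature) d (M : orderTopologicalType d) (E : expansion S M).
Context (dM : dense_without_endpoints M) (lM : star_locally_weakly_o_minimal E).
Context (cM : star_continuity E).

Notation pt n := {ptws 'I_n -> M}.

Definition fiber n (Y : set (pt n.+1)) (u : pt n) : set M := [set y | Y (snoc u y)].

Lemma fiber_definable n (Y : set (pt n.+1)) u : dfn E Y -> definable1 E (fiber Y u).
Proof.
move=> dY; apply/dfnP.
by apply: (dfn_subst (v := fun z : 'I_1 -> M => snoc u (z ord0)) dY) => j; dterm.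
Qed.

Lemma box_definable n (a b : 'I_n -> M) : dfn E (box a b).
Proof. by rewrite /box; dfn_tac. Qed.

(** The form in which the continuity property is used: lower and upper semicontinuity of the
    supremum, stated through the fibers so that the completion disappears. *)
Lemma sup_continuous n (Y : set (pt n.+1)) (B : set (pt n)) : dfn E Y -> big B ->
  (forall u, B u -> (exists y, Y (snoc u y)) /\ exists b, forall y, Y (snoc u y) -> y <= b) ->
  exists U : set (pt n), [/\ open U, U !=set0, U `<=` B &
    forall u c, U u ->
     ((exists y, Y (snoc u y) /\ c < y) ->
        nbhs u [set v : pt n | exists y, Y (snoc v y) /\ c < y]) /\
     ((exists b, b < c /\ forall y, Y (snoc u y) -> y <= b) ->
        nbhs u [set v : pt n | exists b, b < c /\ forall y, Y (snoc v y) -> y <= b])].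
Proof.
move=> dY [x /(nbhs_boxP dM)[a [b [xab abB]]]] YB.
have [[x0] _ _ _] := dM.
(* Outside the box the supremum may not exist; the default value is harmless there. *)
pose f (u : pt n) : completion E :=
  xget (Elt E x0) (supremums [set Elt E y | y in fiber Y u]).
have fsup u : box a b u -> supremums [set Elt E y | y in fiber Y u] (f u).
  move=> /abB /YB[[y Yy] [e Ye]]; apply: xgetPex.
  by apply: (sup_exists (b := e)) => //; [exact: fiber_definable|exists y].
have df : definable_fun (box a b) f.
  (* [Y] is cut down to the box because the domain of a definable function is exactly the projection
     of the set defining it. *)
  exists [set w : pt n.+1 | box a b (init w) /\ Y w]; split.
  - by apply/dfnP; have := box_definable a b => dB; dfn_tac.
  - apply/seteqP; split=> u /=; last by move=> [y []]; rewrite init_snoc.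
    by move=> ub; have /abB/YB[[y Yy] _] := ub; exists y; rewrite init_snoc.
  - move=> u ub; rewrite (_ : [set y | _] = fiber Y u); first exact: fsup.
    by apply/seteqP; split=> y /=; rewrite init_snoc => // -[].
have [U [oU U0 Ub fU]] := cM (box_open_box a b) (ex_intro _ x xab) df.
have {}oU := open_box_open oU.
exists U; split=> // [|u c Uu]; first exact: subset_trans abB.
move: fU; rewrite continuous_open_subspace// => fU.
have fu : {for u, continuous f} by apply: fU; rewrite inE.
have near_U : nbhs u U by exact: open_nbhs_nbhs.
split=> [/(lt_sup _ (fsup _ (Ub _ Uu))) cf|/(sup_lt _ (fsup _ (Ub _ Uu))) fc].
  have : nbhs (f u) [set t | Elt E c < t].
    by apply: open_nbhs_nbhs; split=> //; have := rray_open (Elt E c); rewrite set_itvE.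
  move=> /fu; apply: filterS2 near_U => v Uv /=.
  by rewrite (lt_sup _ (fsup _ (Ub _ Uv))).
have : nbhs (f u) [set t | t < Elt E c].
  by apply: open_nbhs_nbhs; split=> //; have := lray_open (Elt E c); rewrite set_itvE.
move=> /fu; apply: filterS2 near_U => v Uv /=.
by rewrite (sup_lt _ (fsup _ (Ub _ Uv))).
Qed.

End Fibres.

(** * Sets with nonempty interior *)

Section Largeness.
Context (S : signature) d (M : orderTopologicalType d) (E : expansion S M).
Context (dM : dense_without_endpoints M) (lM : star_locally_weakly_o_minimal E).
Context (cM : star_continuity E).

Notation pt n := {ptws 'I_n -> M}.

(** A predicate of [n], because the proof is by induction: the results on families over [M^n] assume
    it at [n] and serve to prove it at [n.+1]. *)
Definition big_union n : Prop := forall X1 X2 : set (pt n), dfn E X1 -> dfn E X2 ->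
  big (X1 `|` X2) -> big X1 \/ big X2.

Lemma open_big n (U : set (pt n)) u : open U -> U u -> big U.
Proof. by move=> oU Uu; exists u; exact: open_nbhs_nbhs. Qed.

(** Take an arbitrary [c]. If it fails, the fibers bounded by [c] have a large base, their suprema
    are generically continuous, and a level just below a point of one fiber works nearby. *)
Lemma big_above n (T : set (pt n.+1)) : big_union n -> dfn E T ->
  big [set u : pt n | exists y, T (snoc u y)] ->
  exists c, big [set u : pt n | exists y, T (snoc u y) /\ c < y].
Proof.
move=> bigU dT bT; have [[c] _ _ _] := dM.
pose X1 := [set u : pt n | exists y, T (snoc u y) /\ c < y].
pose X2 := [set u : pt n | (exists y, T (snoc u y)) /\ ~ exists y, T (snoc u y) /\ c < y].
have dX1 : dfn E X1 by rewrite /X1; dfn_tac.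
have dX2 : dfn E X2 by rewrite /X2; dfn_tac.
have [|b1|b2] := bigU X1 X2 dX1 dX2; [|by exists c|].
  apply: (big_subset _ bT) => u Tu; have [X1u|X1u] := pselect (X1 u); first by left.
  by right.
have [u [[y Ty] nT]|U [oU [u Uu] UX cont]] := sup_continuous dM cM dT b2.
  split; first by exists y.
  exists c => z Tz; rewrite leNgt; apply/negP => cz; apply: nT; by exists z.
have [[y Ty] _] := UX _ Uu; have [e ey] := below dM y; exists e, u.
by apply: (cont u e Uu).1; exists y.
Qed.

(** An interval of the fiber is chosen definably, its ends being suprema of the fibers of two sets
    [L] and [G]. Continuity of both gives one interval that serves all nearby fibers. *)
Lemma big_fibers n (Z : set (pt n.+1)) : big_union n -> dfn E Z ->
  big [set u : pt n | exists p q, p < q /\ forall y, p < y < q -> Z (snoc u y)] -> big Z.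
Proof.
move=> bigU dZ bZ.
pose T := [set w : pt n.+1 | exists p q, p < final w < q /\
  forall y, p < y < q -> Z (snoc (init w) y)].
have dT : dfn E T by rewrite /T; dfn_tac.
have [|c bc] := big_above bigU dT.
  apply: (big_subset _ bZ) => u [p [q [pq uZ]]]; have [y pyq] := dense_between dM pq.
  by exists y, p, q; rewrite init_snoc final_snoc.
(* The supremum of a fiber of [L] is the infimum of the points of [T] above [c], the left end of the
   chosen interval. *)
pose L := [set w : pt n.+1 | forall t, T (snoc (init w) t) /\ c < t -> final w <= t].
have dL : dfn E L by rewrite /L; dfn_tac.
have fL u : fiber L u = [set y | forall t, T (snoc u t) /\ c < t -> y <= t].
  by apply/seteqP; split=> y; rewrite /fiber /L /= init_snoc final_snoc.
have cL u : (exists y, T (snoc u y) /\ c < y) -> cut E (fiber L u).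
  move=> uT; rewrite fL; apply: (lower_bounds_cut dM (c := c)) => // [|x [_ /ltW]//].
  by apply/dfnP; dfn_tac.
have Lc u : L (snoc u c) by have : fiber L u c; [rewrite fL => t [_ /ltW]|].
have [u uT|U1 [oU1 [u0 U1u0] U1T cont1]] := sup_continuous dM cM dL bc.
  split; first by exists c.
  have [e Le] := cut_upper (cL u uT); exists e => y Ly; rewrite leNgt; apply/negP => /ltW ey.
  exact/Le/(cut_le (cL u uT) ey).
have c0 := cL u0 (U1T _ U1u0).
have bounded u y e : cut E (fiber L u) -> ~ L (snoc u y) -> L (snoc u e) -> e <= y.
  move=> cu Ly Le; rewrite leNgt; apply/negP => /ltW ye.
  exact/Ly/(cut_le cu ye).
have [e0 Le0] := cut_upper c0.
have [e1 Le1 e10] := cut_nomin c0 Le0.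
(* Near [u0] the fixed element [e0] stays above the left end, so it can cap the fibers of [G]. *)
have bB : big (U1 `&` [set u : pt n | ~ L (snoc u e0)]).
  exists u0; apply: filterI; first exact: open_nbhs_nbhs.
  apply: filterS ((cont1 u0 e0 U1u0).2 _).
    by move=> u [b [be0 Lb]] /Lb; rewrite leNgt be0.
  by exists e1; split=> // y; exact: bounded.
(* The fiber of [G] reaches as far as the interval from the left end stays inside [Z], but not
   beyond [e0]. *)
pose G := [set w : pt n.+1 | final w <= e0 /\
  forall z, z < final w -> ~ L (snoc (init w) z) -> Z (snoc (init w) z)].
have dG : dfn E G by rewrite /G; dfn_tac.
have GE u y : G (snoc u y) <-> y <= e0 /\ forall z, z < y -> ~ L (snoc u z) -> Z (snoc u z).
  by rewrite /G /= init_snoc final_snoc.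
have [u [U1u Lu]|U2 [oU2 [u1 U2u1] U2B cont2]] := sup_continuous dM cM dG bB.
  have cu := cL _ (U1T _ U1u); split; last by exists e0 => y /GE[].
  exists c; apply/GE; split; first exact: bounded (Lc u).
  by move=> z /ltW zc []; exact: (cut_le cu zc (Lc u)).
have [U1u1 Lu1] := U2B _ U2u1; have c1 := cL _ (U1T _ U1u1).
have [g Gg Lg] : exists2 g, G (snoc u1 g) & ~ L (snoc u1 g).
  case: (cut_germ lM c1 (fiber_definable u1 dT)) => -[y Ly yT].
    exists (Order.min y e0); last by case: (leP y e0).
    apply/GE; split; first by rewrite ge_min lexx orbT.
    move=> z; rewrite lt_min => /andP[zy _] Lz.
    have [p [q []]] : T (snoc u1 z) by exact: yT.
    by rewrite final_snoc init_snoc => pq; apply.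
  (* If [T] were absent just above the left end, the infimum [t] would lie in [T]; but [T] is open
     in each fiber and has a smaller element [s] above [c]. *)
  exfalso; move: (Ly); rewrite fL => /existsNP[t /not_implyP[[Tt ct] /negP]].
  rewrite -ltNge => ty; apply: (yT t) => //; split=> // Lt.
  have [p [q [/andP[pt tq] uZ]]] := Tt; rewrite final_snoc in pt tq.
  have [s /andP[ms st]] : exists s, Order.max p c < s < t.
    by apply: (dense_between dM); rewrite gt_max pt ct.
  move: ms; rewrite gt_max => /andP[ps cs].
  have : s < s; last by rewrite ltxx.
  apply: (lt_le_trans st); move: Lt; rewrite fL => /(_ s); apply; split=> //.
  exists p, q; rewrite final_snoc ps (lt_trans st tq) init_snoc; split=> //.
  by rewrite init_snoc in uZ.
(* The interval []p, q[] is strictly between the suprema of [L] and [G] over [u1], which leaves room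
   for both to move. *)
have [q Lq qg] := cut_nomin c1 Lg; have [p Lp pq] := cut_nomin c1 Lq.
have [p1 Lp1 p1p] := cut_nomin c1 Lp; have [z pzq] := dense_between dM pq.
have nG : nbhs u1 [set v : pt n | exists y, G (snoc v y) /\ q < y].
  by apply: (cont2 u1 q U2u1).1; exists g.
have nL : nbhs u1 [set v : pt n | exists b, b < p /\ forall y, L (snoc v y) -> y <= b].
  by apply: (cont1 u1 p U1u1).2; exists p1; split=> // y; exact: bounded.
exists (snoc u1 z); apply: near_subset (near_snoc dM (filterI nG nL) pzq).
move=> w [[[y [/GE[_ yZ] qy]] [b [bp Lb]]] /andP[pw wq]].
rewrite -(snoc_eta w); apply: yZ; first exact: lt_trans wq qy.
by move=> /Lb; rewrite leNgt (lt_trans bp pw).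
Qed.

Lemma cut_le_set (a : M) : cut E [set y | y <= a].
Proof.
split.
- by apply/dfnP; dfn_tac.
- by exists a => /=.
- by have [b ab] := above dM a; exists b => /=; rewrite leNgt ab.
- by move=> x y xy /=; exact: le_trans.
- move=> b /= /negP; rewrite -ltNge => ab; have [c /andP[ac cb]] := dense_between dM ab.
  by exists c => //=; rewrite leNgt ac.
Qed.

(** Over each [u] near [init x], the right germ at [final x] decides [X1], so the fiber of [X1] or
    of [X2] contains an interval. The induction hypothesis splits the base and [big_fibers] lifts
    the result. *)
Lemma big_union_holds n : big_union n.
Proof.
elim: n => [|n IH] X1 X2 dX1 dX2 [x xX].
  have nx (A : set (pt 0)) : A x -> nbhs x A.
    move=> Ax; apply/(nbhs_boxP dM); exists x, x; split=> [[]//|y _].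
    by rewrite (_ : y = x) //; apply/funext => -[].
  by case: (nbhs_singleton xX) => Xx; [left|right]; exists x; exact: nx.
have [U [p [q [xU /andP[px xq] UX]]]] := near_unsnoc dM xX.
pose I X := [set u : pt n | exists p q, p < q /\ forall y, p < y < q -> X (snoc u y)].
have dI X : dfn E X -> dfn E (I X) by move=> dX; rewrite /I; dfn_tac.
suff [bI|bI] : big (I X1) \/ big (I X2).
  - by left; exact: big_fibers bI.
  - by right; exact: big_fibers bI.
apply: IH; [exact: dI|exact: dI|]; exists (init x); apply: filterS xU => u Uu.
have ca := cut_le_set (final x).
have gt_cut z : final x < z -> ~ (z <= final x) by rewrite ltNge => /negP.
case: (cut_germ lM ca (fiber_definable u dX1)) => -[y /= /negP]; rewrite -ltNge => xy yX.
  left; exists (final x), y; split=> // z /andP[xz zy]; apply: (yX z).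
  by split=> //; exact: gt_cut.
right; exists (final x), (Order.min y q); rewrite lt_min xy xq; split=> // z.
rewrite lt_min => /andP[xz /andP[zy zq]].
have [X1z|//] : (X1 `|` X2) (snoc u z) by apply: UX; rewrite // (lt_trans px).
by case: (yX z) => //; split=> //; exact: gt_cut.
Qed.

(* A fiber of [Z] over a generic point has empty interior, hence is discrete, so the
   least point of [T] above a suitable level is isolated in it; continuity of this
   point and of its two neighbours makes the isolation uniform. *)
Lemma local_graph n (Z T : set (pt n.+1)) : dfn E Z -> dfn E T -> T `<=` Z -> ~ big Z ->
  big [set u : pt n | exists y, T (snoc u y)] ->
  exists (U : set (pt n)) (f : pt n -> M) (p q : M), [/\ open U, U !=set0 &
    forall u, U u -> [/\ p < f u < q, T (snoc u (f u)),
      forall y, p < y < q -> Z (snoc u y) -> y = f u &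
      forall b c, b < f u < c -> nbhs u [set v : pt n | b < f v < c]]].
Proof.
move=> dZ dT TZ nZ bT.
(* [A] is not large, by [big_fibers]; off [A] the fibers of [Z] have no interior. *)
pose A := [set u : pt n | exists p q, p < q /\ forall y, p < y < q -> Z (snoc u y)].
have dA : dfn E A by rewrite /A; dfn_tac.
pose T0 := [set w : pt n.+1 | T w /\ ~ A (init w)].
have dT0 : dfn E T0 by rewrite /T0; dfn_tac.
have [|c bc] := big_above (@big_union_holds n) dT0.
  have dT' : dfn E [set u : pt n | exists y, T0 (snoc u y)] by dfn_tac.
  have [|//|/(big_fibers (@big_union_holds n) dZ)//] := @big_union_holds n _ _ dT' dA.
  apply: (big_subset _ bT) => u [y Ty]; have [Au|nAu] := pselect (A u); first by right.
  by left; exists y; rewrite /T0 /= init_snoc.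
pose B := [set u : pt n | exists y, T0 (snoc u y) /\ c < y].
have BZ u : B u -> no_interior (fiber Z u).
  move=> [y [[_ +] _]]; rewrite init_snoc => nA p q pq; apply: contrapT => h; apply: nA.
  exists p, q; split=> // z pzq; apply: contrapT => Zz; apply: h; by exists z.
pose m u := [set y | T (snoc u y) /\ c < y /\ forall t, T (snoc u t) -> c < t -> y <= t].
have mex u : B u -> exists y, m u y.
  move=> Bu; have [y0 [[Ty0 _] cy0]] := Bu.
  pose X := [set y | T (snoc u y) /\ c < y].
  have [||||y [Ty cy] ymin] := @no_interior_min _ _ _ E dM lM X c.
  - by apply/dfnP; rewrite /X; dfn_tac.
  - move=> p q pq; have [z pzq Zz] := BZ u Bu p q pq; exists z => // -[/TZ ? _].
    exact: Zz.
  - by exists y0.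
  - by move=> x [_ /ltW].
  - by exists y; split=> //; split=> // t Tt ct; exact: ymin.
pose f u := xget c (m u).
have fm u : B u -> m u (f u) by move=> /mex; exact: xgetPex.
(* The supremum of the fiber of [L] is [f u], so continuity of [f] comes from [sup_continuous]. *)
pose L := [set w : pt n.+1 | forall t, T (snoc (init w) t) -> c < t -> final w <= t].
have dL : dfn E L by rewrite /L; dfn_tac.
have LE u y : B u -> L (snoc u y) <-> y <= f u.
  move=> Bu; rewrite /L /= init_snoc final_snoc; have [Tf [cf fmin]] := fm u Bu.
  split=> [|yf t Tt ct]; first exact.
  exact/(le_trans yf)/fmin.
have [u Bu|U1 [oU1 [u0 U1u0] U1B cont1]] := sup_continuous dM cM dL bc.
  by split; exists (f u); [rewrite LE|move=> y; rewrite LE].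
have fcont u b e : U1 u -> b < f u < e -> nbhs u [set v : pt n | b < f v < e].
  move=> U1u /andP[bf fe]; have nU : nbhs u U1 by exact: open_nbhs_nbhs.
  have n1 : nbhs u [set v : pt n | exists y, L (snoc v y) /\ b < y].
    by apply: (cont1 u b U1u).1; exists (f u); rewrite LE //; exact: U1B.
  have n2 : nbhs u [set v : pt n | exists b, b < e /\ forall y, L (snoc v y) -> y <= b].
    by apply: (cont1 u e U1u).2; exists (f u); split=> // y; rewrite LE //; exact: U1B.
  apply: filterS3 nU n1 n2 => v /U1B Bv [y [+ cy]] [b' [b'e Lb']] /=.
  by rewrite LE // => yf; rewrite (lt_le_trans cy yf) (le_lt_trans _ b'e) // Lb' // LE.
have [e' ef] := below dM (f u0); have [e fe] := above dM (f u0).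
have b1 : big (U1 `&` [set v : pt n | e' < f v < e]).
  exists u0; apply: filterI; first exact: open_nbhs_nbhs.
  by apply: fcont; rewrite // ef fe.
(* The supremum of this fiber is the infimum of the points of [Z] above [f u], lowered to at most
   [e]; [~ L] encodes being above [f u]. *)
pose G := [set w : pt n.+1 | final w <= e /\ forall z, z < final w ->
   ~ L (snoc (init w) z) -> ~ Z (snoc (init w) z)].
have dG : dfn E G by rewrite /G; dfn_tac.
have GE u y : B u -> G (snoc u y) <-> y <= e /\ forall z, f u < z < y -> ~ Z (snoc u z).
  move=> Bu; rewrite /G /= init_snoc final_snoc; split=> -[ye yZ]; split=> // z.
    by move=> /andP[fz zy]; apply: yZ => //; rewrite LE // leNgt fz.
  by rewrite LE // => zy /negP; rewrite -ltNge => fz; apply: yZ; rewrite fz.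
have [u [/U1B Bu /andP[_ fue]]|U2 [oU2 [u2 U2u2] U2B cont2]] := sup_continuous dM cM dG b1.
  split; last by exists e => y /(GE _ _ Bu)[].
  exists (f u); apply/(GE _ _ Bu); split; first exact: ltW.
  by move=> z /andP[+ /lt_trans h] => /h; rewrite ltxx.
(* Dually, the supremum of the points of [Z] below [f u], raised to at least [e']; the clause on
   [z'] says that [z < f u]. *)
pose H := [set w : pt n.+1 | final w <= e' \/ exists z, Z (snoc (init w) z) /\
   final w <= z /\ exists z', z < z' /\ L (snoc (init w) z')].
have dH : dfn E H by rewrite /H; dfn_tac.
have HE u y : B u -> H (snoc u y) <-> y <= e' \/ exists z, [/\ Z (snoc u z), y <= z & z < f u].
  move=> Bu; rewrite /H /= init_snoc final_snoc; split=> -[|[z zP]]; [by left|right|by left|right].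
    case: zP => Zz [yz [z' [zz' +]]]; rewrite LE // => z'f.
    by exists z; split=> //; exact: lt_le_trans z'f.
  by case: zP => Zz yz zf; exists z; split=> //; split=> //; exists (f u); rewrite LE.
have [u /U2B[/U1B Bu /andP[e'f _]]|U3 [oU3 [u3 U3u3] U3U2 cont3]] :=
    sup_continuous dM cM dH (open_big oU2 U2u2).
  split; first by exists e'; apply/(HE _ _ Bu); left.
  exists (f u) => y /(HE _ _ Bu)[ye|[z [_ yz /ltW]]]; last exact: le_trans.
  exact: le_trans (ltW e'f).
have U2u3 := U3U2 _ U3u3; have [U1u3 /andP[e'f3 f3e]] := U2B _ U2u3; have Bu3 := U1B _ U1u3.
have [b1' [b2' [/andP[b1f fb2] iso]]] :=
  no_interior_isolated dM lM (f u3) (fiber_definable u3 dZ) (BZ _ Bu3).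
(* Isolation at [u3] leaves a margin between []p, q[] and the other points of [Z]; continuity keeps
   them apart for nearby fibers. *)
have [q /andP[fq qb]] : exists q, f u3 < q < Order.min b2' e.
  by apply: (dense_between dM); rewrite lt_min fb2.
have [p /andP[bp pf]] : exists p, Order.max b1' e' < p < f u3.
  by apply: (dense_between dM); rewrite gt_max b1f.
have nG : nbhs u3 [set v : pt n | exists y, G (snoc v y) /\ q < y].
  apply: (cont2 u3 q U2u3).1; exists (Order.min b2' e); split=> //; apply/(GE _ _ Bu3).
  split=> [|z /andP[fz]]; first by rewrite ge_min lexx orbT.
  rewrite lt_min => /andP[zb _] Zz; have /iso : b1' < z < b2' by rewrite zb (lt_trans b1f fz).
  by move=> /(_ Zz) zf; rewrite zf ltxx in fz.
have nH : nbhs u3 [set v : pt n | exists b, b < p /\ forall y, H (snoc v y) -> y <= b].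
  apply: (cont3 u3 p U3u3).2; exists (Order.max b1' e'); split=> // y /(HE _ _ Bu3).
  move=> [ye'|[z [Zz yz zf]]]; first by rewrite le_max ye' orbT.
  rewrite le_max leNgt; case: ltP => //= b1y.
  have /iso : b1' < z < b2' by rewrite (lt_le_trans b1y yz) (lt_trans zf fb2).
  by move=> /(_ Zz) zf'; rewrite zf' ltxx in zf.
have nf : nbhs u3 [set v : pt n | p < f v < q] by apply: fcont; rewrite // pf fq.
have nU : nbhs u3 U3 by exact: open_nbhs_nbhs.
pose W := [set v : pt n | U3 v /\ p < f v < q] `&`
  ([set v : pt n | exists y, G (snoc v y) /\ q < y] `&`
   [set v : pt n | exists b, b < p /\ forall y, H (snoc v y) -> y <= b]).
have nW : nbhs u3 W by apply: filterI; apply: filterI.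
exists W°, f, p, q; split; [exact: open_interior|by exists u3|].
move=> u /interior_subset[[/U3U2/U2B[U1u /andP[e'fu fue]] pfq] [[g [Gg qg]] [b [bp' Hb]]]].
have Bu := U1B _ U1u; split=> // [||b0 c0 h]; [by case: (fm u Bu)| |exact: fcont].
move=> y /andP[py yq] Zy; have [yf|fy|//] := ltgtP y (f u).
  have /Hb : H (snoc u y) by apply/(HE _ _ Bu); right; exists y.
  by rewrite leNgt (lt_trans bp' py).
have [_ /(_ y)] := (GE _ _ Bu).1 Gg.
by rewrite fy (lt_trans yq qg) => /(_ isT).
Qed.

End Largeness.

(** * Dimension and local graphs *)

Section Dimension.
Context (S : signature) d (M : orderTopologicalType d) (E : expansion S M).
Context (dM : dense_without_endpoints M) (lM : star_locally_weakly_o_minimal E).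
Context (cM : star_continuity E).

Notation pt n := {ptws 'I_n -> M}.

Definition projection n e (tau : 'I_e -> 'I_n) (X : set (pt n)) : set (pt e) :=
  [set u | exists x : pt n, X x /\ forall i, x (tau i) = u i].

(** This is dim X < e: vacuous for [e > n], and emptiness of [X] for [e = 0]. *)
Definition dimlt e n (X : set (pt n)) : Prop :=
  forall tau : 'I_e -> 'I_n, injective tau -> ~ big (projection tau X).

Lemma projection_definable n e (tau : 'I_e -> 'I_n) (X : set (pt n)) :
  dfn E X -> dfn E (projection tau X).
Proof. by move=> dX; rewrite /projection; dfn_tac. Qed.

Lemma dimlt_subset e n (X Y : set (pt n)) : X `<=` Y -> dimlt e Y -> dimlt e X.
Proof.
move=> XY dY tau itau bX; apply: (dY _ itau); apply: big_subset bX.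
by move=> u [x [/XY Yx xu]]; exists x.
Qed.

Lemma dimlt0 e n : dimlt e (set0 : set (pt n)).
Proof. by move=> tau _ [u /nbhs_singleton[x []]]. Qed.

Lemma dimlt_setU e n (X Y : set (pt n)) : dfn E X -> dfn E Y ->
  dimlt e X -> dimlt e Y -> dimlt e (X `|` Y).
Proof.
move=> dX dY eX eY tau itau bXY.
have [|/eX|/eY] := big_union_holds dM lM cM
  (projection_definable tau dX) (projection_definable tau dY).
- by apply: big_subset bXY => u [x [[Xx|Yx] xu]]; [left; exists x|right; exists x].
- exact.
- exact.
Qed.

Lemma dimlt_bigU e n (T : finType) (X : T -> set (pt n)) : (forall t, dfn E (X t)) ->
  (forall t, dimlt e (X t)) -> dimlt e [set x | exists t, X t x].
Proof.
move=> dX eX.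
have H (s : seq T) : dfn E [set x : pt n | exists t, t \in s /\ X t x] /\
    dimlt e [set x : pt n | exists t, t \in s /\ X t x].
  elim: s => [|t s [dIH eIH]].
    rewrite (_ : [set x | _] = set0); last by apply/seteqP; split=> x // [? []].
    by split; [exact: dfn_prop|exact: dimlt0].
  rewrite (_ : [set x | _] = X t `|` [set x | exists t, t \in s /\ X t x]).
    split; last exact: dimlt_setU.
    exact: (dfn_or (dX t) dIH).
  apply/seteqP; split=> x [].
  - by move=> t' []; rewrite inE => /orP[/eqP->|t's] Xx; [left|right; exists t'].
  - by move=> Xx; exists t; rewrite mem_head.
  - by move=> [t' [t's Xx]]; exists t'; rewrite inE t's orbT.
apply: dimlt_subset (H (enum T)).2 => x [t Xx]; exists t.
by rewrite mem_enum.
Qed.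

Lemma closureP n (X : set (pt n)) x : closure X x <->
  forall a b : 'I_n -> M, (forall i, a i < x i < b i) ->
    exists y : 'I_n -> M, X y /\ forall i, a i < y i < b i.
Proof.
split=> [cX a b abx|h B /(nbhs_boxP dM)[a [b [abx abB]]]].
  by have [y [Xy aby]] := cX _ (nbhs_box dM abx); exists y.
by have [y [Xy aby]] := h _ _ abx; exists y; split=> //; exact: abB.
Qed.

Lemma closure_definable n (X : set (pt n)) : dfn E X -> dfn E (closure X).
Proof.
move=> dX; apply: (dfn_ext (fun x => iff_sym (closureP X x))); dfn_tac.
Qed.

(** Otherwise [closure X] minus [X] would be large; but a neighbourhood of a point of the closure
    meets [X]. *)
Lemma big_closure n (X : set (pt n)) : dfn E X -> big (closure X) -> big X.
Proof.
move=> dX bX.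
have dF : dfn E [set x : pt n | closure X x /\ ~ X x].
  by have := closure_definable dX; move: (closure X) => cX dcX; dfn_tac.
have [|//|[x xF]] := big_union_holds dM lM cM dX dF.
  apply: big_subset bX => x Xx; have [|nX] := pselect (X x); [by left|by right].
have [cx _] := nbhs_singleton xF; have [y [Xy [_]]] := cx _ xF.
by [].
Qed.

Lemma dimlt_closure e n (X : set (pt n)) : dfn E X -> dimlt e X -> dimlt e (closure X).
Proof.
move=> dX eX tau itau bX; apply: (eX _ itau).
apply: big_closure; first exact: projection_definable.
apply: big_subset bX => u [x [cx xu]] B nB.
have nB' : nbhs (x \o tau : pt e) B by rewrite (_ : x \o tau = u) //; exact/funext.
have [y [Xy By]] := cx _ (near_comp dM nB').
by exists (y \o tau); split=> //; exists y.
Qed.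

Definition in_chart n e (X : set (pt n)) (tau : 'I_e -> 'I_n) a b p q (x : 'I_n -> M) : Prop :=
  [/\ X x, forall i, a i < x i < b i & forall i, p i < x (tau i) < q i].

(** Existence, uniqueness and continuity, in this order, of the point of [X] above each point of the
    box []p, q[]. The map is never named, which keeps the condition first-order. *)
Definition chart n e (X : set (pt n)) (tau : 'I_e -> 'I_n) a b p q : Prop :=
  [/\ forall u : 'I_e -> M, (forall i, p i < u i < q i) ->
        exists y : 'I_n -> M, in_chart X tau a b p q y /\ forall i, y (tau i) = u i,
      forall y z : 'I_n -> M, in_chart X tau a b p q y /\ in_chart X tau a b p q z ->
        (forall i, y (tau i) = z (tau i)) -> forall j, y j = z j
    & forall y : 'I_n -> M, in_chart X tau a b p q y ->
        forall a' b' : 'I_n -> M, (forall i, a' i < y i < b' i) ->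
        exists p' q' : 'I_e -> M, (forall i, p' i < y (tau i) < q' i) /\
          forall z : 'I_n -> M, in_chart X tau a b p q z ->
            (forall i, p' i < z (tau i) < q' i) -> forall i, a' i < z i < b' i].

(* First-order counterpart of [normal_point], with the continuous map left implicit. *)
Definition locally_graph n e (X : set (pt n)) (tau : 'I_e -> 'I_n) : set (pt n) :=
  [set x | exists a b : 'I_n -> M, exists p q : 'I_e -> M,
    in_chart X tau a b p q x /\ chart X tau a b p q].

Lemma locally_graph_definable n e (X : set (pt n)) (tau : 'I_e -> 'I_n) :
  dfn E X -> dfn E (locally_graph X tau).
Proof.
move=> dX; rewrite /locally_graph /chart /in_chart.
dfn_tac.
Qed.

End Dimension.

(** * Generic charts, frontiers, and normal points *)

Section Charts.
Context (S : signature) d (M : orderTopologicalType d) (E : expansion S M).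
Context (dM : dense_without_endpoints M) (lM : star_locally_weakly_o_minimal E).
Context (cM : star_continuity E).

Notation pt n := {ptws 'I_n -> M}.

Definition overwrite (T : Type) n e (tau : 'I_e -> 'I_n) (p : 'I_e -> T)
    (a : 'I_n -> T) : 'I_n -> T :=
  fun j => if [pick i | tau i == j] is Some i then p i else a j.

Lemma overwrite_in (T : Type) n e (tau : 'I_e -> 'I_n) (p : 'I_e -> T) a i :
  injective tau -> overwrite tau p a (tau i) = p i.
Proof.
move=> itau; rewrite /overwrite; case: pickP => [k /eqP/itau -> //|/(_ i)].
by rewrite eqxx.
Qed.

Lemma overwrite_out (T : Type) n e (tau : 'I_e -> 'I_n) (p : 'I_e -> T) a j :
  j \notin codom tau -> overwrite tau p a j = a j.
Proof.
move=> jtau; rewrite /overwrite; case: pickP => // k /eqP kj.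
by rewrite -kj codom_f in jtau.
Qed.

Lemma snoc_inj n e (tau : 'I_e -> 'I_n) j : injective tau -> j \notin codom tau ->
  injective (snoc tau j).
Proof.
move=> itau jtau i k; case: (unliftP ord_max i) => [i' ->|->];
  case: (unliftP ord_max k) => [k' ->|->]; rewrite ?snoc_lift ?snoc_max //.
- by move=> /itau ->.
- by move=> ij; rewrite -ij codom_f in jtau.
- by move=> ij; rewrite ij codom_f in jtau.
Qed.

(** The coordinates in [s] are treated one at a time: dim X <= e makes the projection to [tau] and
    one more coordinate small, so [local_graph] applies. Points of [Y] are carried along on the
    graph. *)
Lemma locally_graph_on n e (X Y : set (pt n)) (tau : 'I_e -> 'I_n) (s : seq 'I_n) :
  dfn E X -> dfn E Y -> Y `<=` X -> injective tau -> dimlt e.+1 X -> big (projection tau Y) ->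
  (forall j, j \in s -> j \notin codom tau) ->
  exists (p q : 'I_e -> M) (f : pt e -> 'I_n -> M) (a b : 'I_n -> M),
    box p q !=set0 /\ forall u, box p q u ->
    (forall j, j \in s -> [/\ a j < f u j < b j,
        forall c c', c < f u j < c' -> nbhs u [set v : pt e | c < f v j < c'] &
        forall x, X x -> (forall i, x (tau i) = u i) -> a j < x j < b j -> x j = f u j]) /\
    exists y : pt n, [/\ Y y, forall i, y (tau i) = u i & forall j, j \in s -> y j = f u j].
Proof.
move=> dX dY YX itau eX bY.
elim: s => [|j s IH] sP.
  have [u /(nbhs_boxP dM)[p [q [pqu pqY]]]] := bY; have [[c] _ _ _] := dM.
  exists p, q, (fun _ _ => c), (fun=> c), (fun=> c); split; first by exists u.
  by move=> v /pqY[y [Yy yv]]; split=> //; exists y.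
have [|p [q [f [a [b [[u0 pqu0] pqP]]]]]] := IH.
  by move=> i si; apply: sP; rewrite inE si orbT.
have jtau : j \notin codom tau by apply: sP; rewrite mem_head.
(* Only points of [Y] within the bounds already found are kept, so the point supplying coordinate
   [j] also has the earlier coordinates given by [f]. *)
pose Y' := [set y : pt n | Y y /\ ((forall i, p i < y (tau i) < q i) /\
   forall i : 'I_n, i \in s -> a i < y i < b i)].
have dY' : dfn E Y' by rewrite /Y'; dfn_tac.
pose Z := projection (snoc tau j) X; pose T := projection (snoc tau j) Y'.
have dZ : dfn E Z by exact: projection_definable.
have dT : dfn E T by exact: projection_definable.
have [|||U [g [p' [q' [oU [u1 Uu1] UP]]]]] := local_graph dM lM cM dZ dT.
- by move=> u [x [[/YX Xx _] xu]]; exists x.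
- by apply: eX; exact: snoc_inj.
- exists u0; apply: near_subset (nbhs_box dM pqu0) => u pqu.
  have [sf [y [Yy yu ys]]] := pqP _ pqu; exists (y j), y; split.
    split=> //; split=> [i|i si]; first by rewrite yu; exact: pqu.
    by rewrite ys //; case: (sf _ si).
  move=> i; case: (unliftP ord_max i) => [i' ->|->]; rewrite ?snoc_lift ?snoc_max //.
have /(nbhs_boxP dM)[p2 [q2 [pqu1 pqU]]] : nbhs u1 U by exact: open_nbhs_nbhs.
pose upd (x : 'I_n -> M) c := fun i => if i == j then c else x i.
exists p2, q2, (fun u => upd (f u) (g u)), (upd a p'), (upd b q'); split; first by exists u1.
move=> u /pqU /UP[gu [y [[Yy [ypq yab]] yu]] Zg gc].
have yu' i : y (tau i) = u i by have := yu (lift ord_max i); rewrite !snoc_lift.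
have yj : y j = g u by have := yu ord_max; rewrite !snoc_max.
have [|sf _] := pqP u; first by move=> i; rewrite -yu'; exact: ypq.
split=> [i|].
  rewrite inE /upd; case: eqVneq => [-> _|ij /= /sf//]; split=> // x Xx xu xj.
  apply: Zg => //; exists x; split=> // k.
  by case: (unliftP ord_max k) => [k' ->|->]; rewrite ?snoc_lift ?snoc_max.
exists y; split=> // i; rewrite inE /upd; case: eqVneq => [-> //|ij /= si].
by have [_ _] := sf _ si; apply; [exact: YX|exact: yu'|exact: yab].
Qed.

(** Used with [Y] an exceptional subset of [X]: if its projection were large, a whole chart of [X]
    would consist of exceptional points. *)
Lemma generic_chart n e (X Y : set (pt n)) (tau : 'I_e -> 'I_n) :
  dfn E X -> dfn E Y -> Y `<=` X -> injective tau -> dimlt e.+1 X -> big (projection tau Y) ->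
  exists a b p q, [/\ exists x, in_chart X tau a b p q x, chart X tau a b p q &
    in_chart X tau a b p q `<=` Y].
Proof.
move=> dX dY YX itau eX bY.
pose s := [seq j <- enum 'I_n | j \notin codom tau].
have sE j : (j \in s) = (j \notin codom tau) by rewrite mem_filter mem_enum andbT.
have [|p [q [f [a [b [[u0 pqu0] pqP]]]]]] := @locally_graph_on n e X Y tau s dX dY YX itau eX bY.
  by move=> j; rewrite sE.
(* [a] and [b] are meaningful only off [tau]; in the coordinates of [tau] they are replaced by [p]
   and [q]. *)
pose A := overwrite tau p a; pose B := overwrite tau q b.
have inP x : in_chart X tau A B p q x -> box p q (x \o tau) /\
    forall j, j \in s -> x j = f (x \o tau) j.
  move=> [Xx xAB xpq]; split=> // j js; have [sf _] := pqP _ xpq.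
  have [_ _] := sf _ js; apply=> //; have := xAB j.
  by rewrite /A /B !overwrite_out // -sE.
have ext (y z : 'I_n -> M) : (forall i, y (tau i) = z (tau i)) ->
    (forall j, j \in s -> y j = z j) -> y = z.
  move=> yz1 yz2; apply/funext => j; have [/codomP[i ->]|js] := boolP (j \in codom tau).
    exact: yz1.
  by apply: yz2; rewrite sE.
have inY u : box p q u -> exists y : pt n, [/\ Y y, in_chart X tau A B p q y &
    forall i, y (tau i) = u i].
  move=> pqu; have [sf [y [Yy yu ys]]] := pqP _ pqu; exists y; split=> //.
  split=> [|j|i]; [exact: YX| |by rewrite yu; exact: pqu].
  have [/codomP[i ->]|js] := boolP (j \in codom tau).
    by rewrite /A /B !overwrite_in // yu; exact: pqu.
  rewrite /A /B !overwrite_out // ys ?sE //.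
  by have [|//] := sf j; rewrite sE.
exists A, B, p, q; split; last first.
- move=> x inx; have [xpq xs] := inP _ inx.
  have [_ [y [Yy yu ys]]] := pqP _ xpq; rewrite (_ : x = y) //.
  by apply: ext => [i|j js]; rewrite ?yu // ys // xs.
- split.
  + by move=> u /inY[y [_ iny yu]]; exists y.
  + move=> y z [/inP[_ ys] /inP[_ zs]] yz j.
    have e1 : y \o tau = z \o tau by exact/funext.
    by rewrite (ext y z) // => k ks; rewrite ys // zs // e1.
  + move=> y iny a' b' yab; have [ypq ys] := inP _ iny.
    have [sf _] := pqP _ ypq.
    have n1 : nbhs (y \o tau : pt e) [set v : pt e | forall j, j \in s -> a' j < f v j < b' j].
      apply: (near_all (f := fun j v => j \in s -> a' j < f v j < b' j)) => j.
      have [js|js] := boolP (j \in s); last first.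
        by apply: filterE.
      have [_ fc _] := sf _ js; apply: near_subset (fc (a' j) (b' j) _) => [v h _ //|].
      by rewrite -ys.
    have n2 : nbhs (y \o tau : pt e) [set v : pt e | forall i, a' (tau i) < v i < b' (tau i)].
      apply: (near_all (f := fun i v => a' (tau i) < v i < b' (tau i))) => i.
      by apply: (near_itv dM); exact: yab.
    have [p' [q' [ypq' pqf]]] := (nbhs_boxP dM _ _).1 (filterI n1 n2 : nbhs (y \o tau : pt e) _).
    exists p', q'; split=> // z /inP[_ zs] /pqf[zf zt] j.
    have [/codomP[i ->]|js] := boolP (j \in codom tau); first exact: zt.
    by rewrite zs ?sE //; apply: zf; rewrite sE.
- by have [y [_ iny _]] := inY _ pqu0; exists y.
Qed.

(** Otherwise some chart of [closure X] lies in the frontier; but a chart is relatively open in the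
    closure, so it meets [X]. *)
Lemma dimlt_frontier n e (X : set (pt n)) : dfn E X -> dimlt e.+1 X ->
  dimlt e [set x | closure X x /\ ~ X x].
Proof.
move=> dX eX tau itau bF; have dcX := closure_definable dM dX.
have dF : dfn E [set x | closure X x /\ ~ X x].
  by move: (closure X) dcX => cX dcX; dfn_tac.
have [|//|a [b [p [q [[x [cx xab xpq]] _ inF]]]]] := generic_chart dcX dF _ itau _ bF.
- by move=> x [].
- exact: (dimlt_closure dM lM cM).
have nx : nbhs (x : pt n) [set y : pt n | (forall i, a i < y i < b i) /\
    forall i, p i < y (tau i) < q i].
  apply: filterI; first exact: nbhs_box.
  by apply: (near_all (f := fun i y => p i < y (tau i) < q i)) => i; exact: near_itv.
have [y [Xy [yab ypq]]] := cx _ nx.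
have [] : [set x | closure X x /\ ~ X x] y; last by [].
by apply: inF; split=> //; exact: subset_closure.
Qed.

(** Every point of a chart is locally a graph, so no chart fits in this set. Finite functions make
    the quantifier over [tau] a finite conjunction. *)
Lemma dimlt_not_locally_graph n e (X : set (pt n)) : dfn E X -> dimlt e.+1 X ->
  dimlt e [set x | X x /\ forall tau : {ffun 'I_e -> 'I_n},
    injective tau -> ~ locally_graph X tau x].
Proof.
move=> dX eX tau itau bN; set N := [set x | _] in bN.
have dN : dfn E N.
  have dL (tau' : {ffun 'I_e -> 'I_n}) := locally_graph_definable tau' dX.
  apply: dfn_and => //; apply: dfn_all_fin => t; apply: dfn_imp; first exact: dfn_prop.
  exact/dfn_not/dL.
have [|a [b [p [q [[x inx] ch inN]]]]] := generic_chart dX dN _ itau eX bN.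
  by move=> x [].
have tauE : finfun tau = tau :> ('I_e -> 'I_n) by apply/funext => i; rewrite ffunE.
have [_ /(_ (finfun tau))] := inN _ inx; rewrite tauE; apply=> //.
by exists a, b, p, q.
Qed.

Lemma in_chart_near n e (X : set (pt n)) (tau : 'I_e -> 'I_n) a b p q x :
  in_chart X tau a b p q x -> nbhs (x : pt n) [set y : pt n | X y -> in_chart X tau a b p q y].
Proof.
move=> [Xx xab xpq].
have n1 : nbhs (x : pt n) (box a b) by exact: nbhs_box.
have n2 : nbhs (x : pt n) [set y : pt n | forall i, p i < y (tau i) < q i].
  by apply: (near_all (f := fun i y => p i < y (tau i) < q i)) => i; exact: near_itv.
by apply: filterS2 n1 n2 => y yab ypq Xy; split.
Qed.

Lemma locally_graph_near n e (X : set (pt n)) (tau : 'I_e -> 'I_n) x :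
  locally_graph X tau x -> nbhs x [set y | X y -> locally_graph X tau y].
Proof.
move=> [a [b [p [q [inx ch]]]]]; apply: near_subset (in_chart_near inx) => y h /h iny.
by exists a, b, p, q.
Qed.

(** The chart is shrunk: by its continuity clause at [x], points above a small box of
    [tau]-coordinates stay where [X] and [Y] agree, so existence survives. *)
Lemma locally_graph_local n e (X Y : set (pt n)) (tau : 'I_e -> 'I_n) x :
  nbhs x [set y | X y <-> Y y] -> locally_graph X tau x -> locally_graph Y tau x.
Proof.
move=> /(nbhs_boxP dM)[a' [b' [xab' XY]]] [a [b [p [q [inx [ch1 ch2 ch3]]]]]].
have [p' [q' [xpq' ch4]]] := ch3 _ inx a' b' xab'.
have [Xx xab xpq] := inx.
pose A j := Order.max (a j) (a' j); pose B j := Order.min (b j) (b' j).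
pose P j := Order.max (p j) (p' j); pose Q j := Order.min (q j) (q' j).
have between (c1 c2 e1 e2 t : M) :
    (Order.max c1 c2 < t < Order.min e1 e2) = (c1 < t < e1) && (c2 < t < e2).
  by rewrite gt_max lt_min andbACA.
have inE y : in_chart Y tau A B P Q y <->
    in_chart X tau a b p q y /\ forall i, p' i < y (tau i) < q' i.
  split=> [[Yy yAB yPQ]|[iny ypq']].
    have yab' : box a' b' y by move=> i; have := yAB i; rewrite between => /andP[].
    split=> [|i]; last by have := yPQ i; rewrite between => /andP[].
    split=> [|i|i]; first by apply/XY.
      by have := yAB i; rewrite between => /andP[].
    by have := yPQ i; rewrite between => /andP[].
  have yab' := ch4 _ iny ypq'; have [Xy yab ypq] := iny.
  split=> [|i|i]; first by apply/XY.
    by rewrite between yab yab'.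
  by rewrite between ypq ypq'.
exists A, B, P, Q; split; first by apply/inE.
split.
- move=> u uPQ; have [|y [iny yu]] := ch1 u.
    by move=> i; have := uPQ i; rewrite between => /andP[].
  exists y; split=> //; apply/inE; split=> // i.
  by rewrite yu; have := uPQ i; rewrite between => /andP[].
- by move=> y z [/inE[iny _] /inE[inz _]]; exact: ch2.
- move=> y /inE[iny _] a2 b2 yab2; have [p2 [q2 [ypq2 h]]] := ch3 _ iny _ _ yab2.
  by exists p2, q2; split=> // z /inE[inz _]; exact: h.
Qed.

Lemma locally_graph_normal n e (X : set (pt n)) (tau : 'I_e -> 'I_n) x :
  injective tau -> locally_graph X tau x -> normal_point X tau x.
Proof.
move=> itau [a [b [p [q [inx [ch1 ch2 ch3]]]]]]; have [Xx xab xpq] := inx.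
split=> //; pose k := #|[predC codom tau]|.
pose r (j : 'I_k) : 'I_n := enum_val j.
pose sigma (i : 'I_(e + k)) : 'I_n :=
  match fintype.split i with inl i => tau i | inr j => r j end.
have sigmaL i : sigma (lshift k i) = tau i.
  by rewrite /sigma (unsplitK (inl i : 'I_e + 'I_k)).
have sigmaR j : sigma (rshift e j) = r j.
  by rewrite /sigma (unsplitK (inr j : 'I_e + 'I_k)).
have rP j : r j \notin codom tau by have := enum_valP j.
have bij : bijective sigma.
  apply: inj_card_bij => [i i'|].
    rewrite -(splitK i) -(splitK i'); case: (fintype.split i) => j;
      case: (fintype.split i') => j' /=;
    rewrite ?sigmaL ?sigmaR.
    - by move=> /itau ->.
    - by move=> jj; have := rP j'; rewrite -jj codom_f.
    - by move=> jj; have := rP j; rewrite jj codom_f.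
    - by move=> /enum_val_inj ->.
  rewrite !card_ord -[X in (X + _)%N](card_ord e) -(card_codom itau).
  by rewrite /k cardC card_ord.
(* The projection of this box is still all of [box p q], since each of its points lifts to a chart
   point, which respects [a] and [b]. *)
pose A := overwrite tau (fun i => Order.max (a (tau i)) (p i)) a.
pose B := overwrite tau (fun i => Order.min (b (tau i)) (q i)) b.
have boxE y : box A B y <-> box a b y /\ box p q (y \o tau).
  split=> [yAB|[yab ypq] j].
    split=> [j|i]; last first.
      have := yAB (tau i); rewrite /A /B !overwrite_in // gt_max lt_min /=.
      by move=> /andP[/andP[_ ->] /andP[_ ->]].
    have [/codomP[i ->]|js] := boolP (j \in codom tau).
      have := yAB (tau i); rewrite /A /B !overwrite_in // gt_max lt_min /=.
      by move=> /andP[/andP[-> _] /andP[-> _]].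
    by have := yAB j; rewrite /A /B !overwrite_out.
  have [/codomP[i ->]|js] := boolP (j \in codom tau).
    rewrite /A /B !overwrite_in // gt_max lt_min.
    by have /andP[-> ->] := yab (tau i); have /andP[/= -> ->] := ypq i.
  by rewrite /A /B !overwrite_out //; exact: yab.
pose y0 (u : pt e) : pt n :=
  xget x [set y : pt n | in_chart X tau a b p q y /\ forall i, y (tau i) = u i].
have y0P u : box p q u -> in_chart X tau a b p q (y0 u) /\ forall i, y0 u (tau i) = u i.
  move=> /ch1[y yP].
  exact: (xgetPex x (ex_intro (fun y : pt n => in_chart X tau a b p q y /\
    forall i, y (tau i) = u i) y yP)).
have pBE : [set y \o tau | y in box A B] = box p q.
  apply/seteqP; split=> u; first by move=> [y /boxE[_ ypq] <-].
  move=> upq; have [[_ yab ypq] yu] := y0P _ upq; exists (y0 u); first by apply/boxE.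
  by apply/funext => i /=.
exists k, sigma, (box A B), (fun u => y0 u \o r); split.
- by split=> //; apply/funext => i /=.
- by split; [exact: box_open_box|apply/boxE].
- rewrite pBE continuous_open_subspace; last exact/open_box_open/box_open_box.
  move=> u; rewrite inE => upq V /(nbhs_boxP dM)[a' [b' [fab fabV]]].
  have [iny yu] := y0P _ upq.
  have [a2 a2y] := choice (fun j => below dM (y0 u j)).
  have [b2 b2y] := choice (fun j => above dM (y0 u j)).
  (* The bounds [a'] and [b'] concern the remaining coordinates; those of [tau] get arbitrary bounds
     around [y0 u]. *)
  pose A2 j := if [pick i | r i == j] is Some i then a' i else a2 j.
  pose B2 j := if [pick i | r i == j] is Some i then b' i else b2 j.
  have [|p' [q' [ypq' h]]] := ch3 _ iny A2 B2.
    move=> j; rewrite /A2 /B2; case: pickP => [i /eqP <-|_]; first exact: fab.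
    by rewrite a2y b2y.
  have upq' : box p' q' u by move=> i; rewrite -yu.
  apply: near_subset (filterI (nbhs_box dM upq) (nbhs_box dM upq')) => v [vpq vpq'].
  apply: fabV => j; have [inv vu] := y0P _ vpq.
  have := h _ inv _ (r j); rewrite /A2 /B2; case: pickP => [i /eqP/enum_val_inj -> |/(_ j)].
    by apply=> i'; rewrite vu; exact: vpq'.
  by rewrite eqxx.
- rewrite pBE; apply/seteqP; split=> z.
    move=> [y [/boxE[yab ypq] Xy] <-].
    have e1 : (y \o sigma) \o lshift k = y \o tau by apply/funext => i /=; rewrite sigmaL.
    rewrite /mkset e1; split=> //; apply/funext => j /=; rewrite sigmaR.
    have [iny yu] := y0P _ ypq; apply: ch2; first by split.
    by move=> i; rewrite yu.
  rewrite /mkset => -[zpq zr]; have [iny yu] := y0P _ zpq.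
  have [Xy yab ypq] := iny.
  exists (y0 (z \o lshift k)); first by split=> //; apply/boxE; split.
  apply/funext => i /=; rewrite -(splitK i); case: (fintype.split i) => j /=.
    by rewrite sigmaL yu.
  by rewrite sigmaR; have := congr1 (@^~ j) zr.
Qed.

End Charts.

(** * The decomposition *)

(* [2 ^ m] atoms times [n ^ e'] choices of coordinates; the closures of these pieces
   join the sets to be partitioned in the next step. *)
Fixpoint decomposition_bound (e m n : nat) : nat :=
  if e is e'.+1 then
    let c := (2 ^ m * n ^ e')%N in (c + decomposition_bound e' (m + c) n)%N
  else 0%N.

Section Decomposition.
Context (S : signature) d (M : orderTopologicalType d) (E : expansion S M).
Context (dM : dense_without_endpoints M) (lM : star_locally_weakly_o_minimal E).
Context (cM : star_continuity E).

Notation pt n := {ptws 'I_n -> M}.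

(** * Top-dimensional pieces of a closed set and what remains *)

Section Stage.
Context (e n : nat) (J : finType) (X : J -> set (pt n)) (W : set (pt n)).
Context (dX : forall j, dfn E (X j)) (dW : dfn E W) (cW : closed W) (eW : dimlt e.+1 W).

Definition atom (A : {ffun J -> bool}) : set (pt n) :=
  [set x | W x /\ forall j, A j <-> X j x].

Definition graph_set (tau : {ffun 'I_e -> 'I_n}) : set (pt n) :=
  [set x | injective tau /\ locally_graph W tau x].

(** A point may be on a graph over several choices of coordinates; the first choice in the
    enumeration is preferred, which makes the pieces disjoint. *)
Definition earlier (tau : {ffun 'I_e -> 'I_n}) : set (pt n) :=
  [set x | exists t, (enum_rank t < enum_rank tau)%N /\ graph_set t x].

Definition off_atom A : set (pt n) := [set x | W x /\ ~ atom A x].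

(** Closures are removed, not just the sets themselves, so that a piece is relatively open in [W];
    the loss consists of frontiers, of dimension < e. *)
Definition piece (i : {ffun J -> bool} * {ffun 'I_e -> 'I_n}) : set (pt n) :=
  [set x | [/\ atom i.1 x, ~ closure (off_atom i.1) x & graph_set i.2 x] /\
    ~ closure (earlier i.2) x].

Definition remainder : set (pt n) := [set x | W x /\ ~ exists i, piece i x].

Lemma atom_definable A : dfn E (atom A).
Proof.
apply: dfn_and => //; apply: dfn_all_fin => j; apply: dfn_iff => //.
exact: dfn_prop.
Qed.

Lemma off_atom_definable A : dfn E (off_atom A).
Proof. by apply: dfn_and => //; apply/dfn_not/atom_definable. Qed.

Lemma graph_set_definable tau : dfn E (graph_set tau).
Proof. by apply: dfn_and; [exact: dfn_prop|exact: locally_graph_definable]. Qed.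

Lemma earlier_definable tau : dfn E (earlier tau).
Proof.
apply: dfn_ex_fin => t; apply: dfn_and; first exact: dfn_prop.
exact: graph_set_definable.
Qed.

Lemma piece_definable i : dfn E (piece i).
Proof.
apply: dfn_and; last exact/dfn_not/closure_definable/earlier_definable.
apply: dfn_and3; [exact: atom_definable| |exact: graph_set_definable].
exact/dfn_not/closure_definable/off_atom_definable.
Qed.

Lemma remainder_definable : dfn E remainder.
Proof. by apply: dfn_and => //; apply/dfn_not/dfn_ex_fin => i; exact: piece_definable. Qed.

Lemma piece_sub i : piece i `<=` W.
Proof. by move=> x [[[]]]. Qed.

Lemma graph_set_sub tau : graph_set tau `<=` W.
Proof. by move=> x [_ [a [b [p [q [[]]]]]]]. Qed.

Lemma earlier_sub tau : earlier tau `<=` W.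
Proof. by move=> x [t [_ /graph_set_sub]]. Qed.

Lemma near_not_closure (A : set (pt n)) x : ~ closure A x -> nbhs x [set y | ~ closure A y].
Proof.
move=> Ax; apply: open_nbhs_nbhs; split=> //.
exact/closed_openC/closed_closure.
Qed.

Lemma piece_near i x : piece i x -> nbhs x [set y | W y -> piece i y].
Proof.
move=> [[Ax /near_not_closure n1 [itau /(locally_graph_near dM) n2]] /near_not_closure n3].
apply: filterS3 n1 n2 n3 => y y1 y2 y3 Wy; split=> //; split=> //; last first.
  by split=> //; exact: y2.
by apply: contrapT => Ay; apply/y1/subset_closure.
Qed.

Lemma piece_trivial i k x : piece i x -> piece k x -> i = k.
Proof.
case: i k => [A tau] [A' tau'] [[/= [_ Ax] _ Nt] nV] [[/= [_ Ax'] _ Nt'] nV'].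
have AA' : A = A'.
  by apply/ffunP => j; apply/idP/idP => [/Ax /Ax'|/Ax' /Ax].
congr pair => //; apply/enum_rank_inj/val_inj => /=.
case: (ltngtP (enum_rank tau) (enum_rank tau')) => // h.
  by case: nV'; apply: subset_closure; exists tau.
by case: nV; apply: subset_closure; exists tau'.
Qed.

Lemma remainder_closed : closed remainder.
Proof.
move=> x cx; split; first by apply: cW; apply: closure_subset cx => y [].
move=> [i /piece_near ix]; have [y [[Wy nC] iy]] := cx _ ix.
by apply: nC; exists i; exact: iy.
Qed.

(** A remaining point is in the frontier of the complement of its atom, or on no local graph, or in
    the frontier of [earlier t] for the first [t] that works there. Each case has dimension < e. *)
Lemma remainder_dimlt : dimlt e remainder.
Proof.
pose fr (A : set (pt n)) := [set x | closure A x /\ ~ A x].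
have dfr A : dfn E A -> dfn E (fr A).
  by move=> dA; apply: dfn_and; [exact: closure_definable|exact: dfn_not].
have efr A : dfn E A -> A `<=` W -> dimlt e (fr A).
  by move=> dA AW; apply: (dimlt_frontier dM lM cM dA); exact: dimlt_subset eW.
pose F1 := [set x | exists A, fr (off_atom A) x].
pose F2 := [set x | W x /\ forall tau : {ffun 'I_e -> 'I_n}, injective tau ->
  ~ locally_graph W tau x].
pose F3 := [set x | exists tau, fr (earlier tau) x].
have dF1 : dfn E F1 by apply: dfn_ex_fin => A; exact/dfr/off_atom_definable.
have dF2 : dfn E F2.
  apply: dfn_and => //; apply: dfn_all_fin => t; apply: dfn_imp; first exact: dfn_prop.
  exact/dfn_not/locally_graph_definable.
have dF3 : dfn E F3 by apply: dfn_ex_fin => t; exact/dfr/earlier_definable.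
apply: (@dimlt_subset _ _ _ _ _ (F1 `|` (F2 `|` F3))); last first.
  apply: (dimlt_setU dM lM cM) => //; first exact: (dfn_or dF2 dF3).
    apply: (dimlt_bigU dM lM cM) => // A; first exact/dfr/off_atom_definable.
    by apply: efr; [exact: off_atom_definable|move=> x []].
  apply: (dimlt_setU dM lM cM) => //; first exact: (dimlt_not_locally_graph dM lM cM).
  apply: (dimlt_bigU dM lM cM) => // t; first exact/dfr/earlier_definable.
  by apply: efr; [exact: earlier_definable|exact: earlier_sub].
move=> x [Wx nC]; pose A := [ffun j => `[< X j x >]].
have Ax : atom A x by split=> // j; rewrite ffunE; split=> [/asboolP|?]; last exact/asboolP.
have [cA|ncA] := pselect (closure (off_atom A) x); first by left; exists A; split=> // -[].
right; have [[t0 t0P]|nt] := pselect (exists t, graph_set t x); last first.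
  by left; split=> // t it Lt; apply: nt; exists t.
right; pose Q t := `[< graph_set t x >]; have Qt0 : Q t0 by exact/asboolP.
case: (arg_minnP (fun t => enum_rank t : nat) Qt0) => t /asboolP tx tmin.
have nV : ~ earlier t x by move=> [t' [t't /asboolP/tmin]]; rewrite leqNgt t't.
exists t; split=> //; apply: contrapT => nc; apply: nC.
by exists (A, t).
Qed.

Lemma piece_normal i : normal_submanifold (piece i).
Proof.
have [it|nit] := pselect (injective i.2); last first.
  (* For a non-injective choice the piece is empty, and any projection will do. *)
  exists 0%N, (@from_ord0 'I_n).
  by split=> [[]//|x [[_ _ []]]].
exists e, i.2; split=> // x ix; apply: (locally_graph_normal dM) => //.
have [[_ _ [_ Lx]] _] := ix; apply: (locally_graph_local dM _ Lx).
apply: near_subset (piece_near ix) => y h; split=> //; exact: piece_sub.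
Qed.

End Stage.

Lemma decomposition_closed e n (J : finType) (X : J -> set (pt n)) (W : set (pt n)) :
  (forall j, dfn E (X j)) -> dfn E W -> closed W -> dimlt e W ->
  exists (I : finType) (C : I -> set (pt n)),
    [/\ forall i, dfn E (C i) /\ normal_submanifold (C i),
        forall i k x, C i x -> C k x -> i = k,
        forall x, W x <-> exists i, C i x,
        forall i j, (forall x, C i x -> ~ X j x) \/ C i `<=` X j &
        forall i k x, closure (C i) x -> C k x -> C k `<=` closure (C i)] /\
    #|I| = decomposition_bound e #|J| n.
Proof.
elim: e J X W => [|e IH] J X W dX dW cW eW.
  exists void, (fun i : void => match i with end); split; last by rewrite card_void.
  split=> [[]|[]|x|[]|[]]; split=> [Wx|[[]]].
  (* Dimension < 0 means that [W] is empty: a nonempty set has large projection to the one-point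
     space. *)
  exfalso; apply: (eW (@from_ord0 'I_n)) => [[]//|].
  exists (@from_ord0 M); apply/(nbhs_boxP dM); exists (@from_ord0 M), (@from_ord0 M).
  by split=> [[]//|u _]; exists x; split=> // -[].
pose I1 : finType := ({ffun J -> bool} * {ffun 'I_e -> 'I_n})%type.
pose C1 : I1 -> set (pt n) := piece X W (e := e).
pose X' (j : J + I1) : set (pt n) := match j with inl j => X j | inr i => closure (C1 i) end.
have dX' j : dfn E (X' j).
  by case: j => [j|i] /=; [exact: dX|apply/(closure_definable dM)/piece_definable].
have [I2 [C2 [[C2P C2d C2W C2X C2F] cI2]]] := IH _ X' _ dX' (remainder_definable e dX dW)
  (@remainder_closed e _ _ X _ cW) (remainder_dimlt dX dW eW).
pose C (i : I1 + I2) : set (pt n) := match i with inl i => C1 i | inr i => C2 i end.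
exists (I1 + I2)%type, C; split; last first.
  rewrite card_sum cI2 /= card_prod !card_ffun.
  by rewrite card_sum card_prod !card_ffun !card_ord card_bool.
have C12 i k x : C1 i x -> C2 k x -> False.
  by move=> ix kx; have [_] : remainder e X W x; [apply/C2W; exists k|apply; exists i].
have C2sub k : C2 k `<=` W by move=> x kx; have [] : remainder e X W x by apply/C2W; exists k.
split.
- case=> i; last exact: C2P.
  by split; [exact: piece_definable|exact: piece_normal].
- case=> i [k|k] x //=.
  + by move=> ix /(piece_trivial ix) ->.
  + by move=> ix /(C12 _ _ _ ix).
  + by move=> ix kx; case: (C12 _ _ _ kx ix).
  + by move=> ix /(C2d _ _ _ ix) ->.
- move=> x; split=> [Wx|[[i /piece_sub//|i /C2sub//]]].
  have [[i ix]|nx] := pselect (exists i, C1 i x); first by exists (inl i).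
  have /C2W[k kx] : remainder e X W x by [].
  by exists (inr k).
- case=> i j; last exact: (C2X i (inl j)).
  case Aj: (i.1 j); [right|left] => x [[[_ Ax] _ _] _]; first exact/Ax.
  by move/Ax; rewrite Aj.
- case=> i [k|k] x /=.
  (* Pieces are relatively open, so one that meets the closure of another meets the other piece
     itself. *)
  + move=> cx kx; suff -> : i = k by exact: subset_closure.
    have [y [iy ky]] := cx _ (piece_near kx).
    by apply: (piece_trivial iy); apply: ky; exact: (piece_sub iy).
  (* The closure of the piece was among the sets partitioned by the lower members. *)
  + by move=> cx kx; case: (C2X k (inr i)) => // /(_ x kx).
  (* The remainder is closed, so closures of lower members miss the pieces. *)
  + move=> cx kx; exfalso; have : remainder e X W x.
      apply: (remainder_closed cW); apply: closure_subset cx => y iy.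
      by apply/C2W; exists i.
    by move=> [_]; apply; exists k.
  + exact: C2F.
Qed.

End Decomposition.

Theorem theorem4p26 :
  exists K : nat -> nat -> nat,
  forall (S : signature) (d : Order.disp_t) (M : orderTopologicalType d)
         (E : expansion S M),
  dense_without_endpoints M ->
  star_locally_weakly_o_minimal E ->
  star_continuity E ->
  forall (m n : nat) (X : 'I_m -> set {ptws 'I_n -> M}),
  (forall j, definable E (X j)) ->
  exists (N : nat) (C : 'I_N -> set {ptws 'I_n -> M}),
    [/\ is_decomposition E C,
        partitioning C X,
        frontier_condition C
      & (N <= K m n)%N].
Proof.
(* The descent starts at [n.+1], where the dimension bound on [M^n] is vacuous. *)
exists (fun m n => decomposition_bound n.+1 m n) => S d M E dM lM cM m n X dX.
have [||||I [C [[CP Cd CT CX CF] cI]]] :=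
    @decomposition_closed S d M E dM lM cM n.+1 n 'I_m X setT.
- by move=> j; exact/dfnP.
- exact: dfn_true.
- exact: closedT.
- by move=> tau /leq_card; rewrite !card_ord ltnn.
exists #|I|, (fun i => C (enum_val i)); split; last by rewrite cI card_ord.
- split=> [i|i j ij|].
  + by have [/dfnP dC nC] := CP (enum_val i).
  + apply/seteqP; split=> x // -[ix jx].
    by move/eqP: ij; apply; exact/enum_val_inj/(Cd _ _ x).
  + apply/seteqP; split=> x // _; have [i ix] := (CT x).1 Logic.I.
    by exists (enum_rank i); rewrite //= enum_rankK.
- move=> i j; have [h|h] := CX (enum_val i) j; [left|by right].
  by apply/seteqP; split=> x // -[/h].
- move=> i; exists [set k | C (enum_val k) `<=` closure (C (enum_val i))].
  apply/seteqP; split=> x.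
    move=> cx; have [k kx] := (CT x).1 Logic.I.
    by exists (enum_rank k); rewrite /= enum_rankK //; exact: CF kx.
  by move=> [k kC kx]; exact: kC.
Qed.
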